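(* For $\Omega\subset\mathbb{R}^d$, $d\geq 2$, denote by $u_\Omega$ the solution of $-\Delta u_\Omega=1$ in $\Omega$, $u_\Omega=0$ on $\partial\Omega$. For $\alpha<d$, any sequence of convex domains $\{\Omega_k\}_{k\geq 1}$ in $\mathbb{R}^d$, with $|\Omega_k|=1$, satisfying $$\liminf_{k\to\infty}|\partial\Omega_k|^{\frac{\alpha-1}{d-1}}\,\|\nabla u_{\Omega_k}\|_{L^\infty(\Omega_k)}>0,$$ is uniformly bounded in the Hausdorff metric. In particular, up to translation any such sequence contains a subsequence converging with respect to the Hausdorff metric.
   Context: Here $\alpha$ is a real number, $|\Omega|$ denotes the $d$-dimensional Lebesgue measure of $\Omega$, $|\partial\Omega|$ the $(d-1)$-dimensional surface measure of $\partial\Omega$, and $\|\nabla u_\Omega\|_{L^\infty(\Omega)}$ the essential supremum over $\Omega$ of the Euclidean norm $|\nabla u_\Omega|$. The Hausdorff metric is $d_H(A,B)=\max\{\sup_{a\in A}\inf_{b\in B}|a-b|,\ \sup_{b\in B}\inf_{a\in A}|a-b|\}$.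
   Formalization: ''Uniformly bounded in the Hausdorff metric'' is proved up to translation (suitable translates of the domains have uniformly bounded mutual distances); literally it fails, e.g. for a unit-volume ball translated to infinity. *)

(* Defs.v *)
From HB Require Import structures.
From mathcomp Require Import all_boot all_order all_algebra.
From mathcomp Require Import all_classical all_reals all_analysis.

Set Implicit Arguments.
Unset Strict Implicit.
Unset Printing Implicit Defensive.

Import Order.TTheory GRing.Theory Num.Theory.
Import numFieldNormedType.Exports.

Local Open Scope classical_set_scope.
Local Open Scope ring_scope.

(* Points of R^n are row vectors 'rV[R]_n.  The library norm on 'rV[R]_n is the
   sup norm: it is used only through the (product) topology it induces, and all
   metric quantities below are based on the Euclidean norm enorm. *)

Definition enorm (R : realType) (n : nat) (x : 'rV[R]_n) : R :=
  Num.sqrt (\sum_i x ord0 i ^+ 2).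

(* Method I construction: infimum of the total weight of the countable covers
   of A by sets of the family S.  A None entry of the covering sequence stands
   for no set at all, so that finite (and empty) covers are allowed. *)
Definition cover_measure (R : realType) (T I : Type)
    (S : I -> set T) (w : I -> \bar R) (A : set T) : \bar R :=
  ereal_inf [set (\sum_(k <oo) oapp w 0 (c k))%E | c in
    [set c : nat -> option I | A `<=` \bigcup_k oapp S set0 (c k)]].

Section cover_measure_theory.
Local Open Scope ereal_scope.
Context (R : realType) (T I : Type) (S : I -> set T) (w : I -> \bar R).
Hypothesis w_ge0 : forall i, 0 <= w i.
Let mu := cover_measure S w.

Let ow_ge0 o : 0 <= oapp w 0 o. Proof. by case: o => /=. Qed.

Lemma cover_measure_ge0 A : 0 <= mu A.
Proof.
by apply: le_ereal_inf_tmp => _ [c _ <-]; apply: nneseries_ge0 => k _ _.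
Qed.

Lemma cover_measure0 : mu set0 = 0.
Proof.
apply/eqP; rewrite eq_le cover_measure_ge0 andbT.
by apply: ereal_inf_lbound; exists (fun=> None) => //=; rewrite eseries0.
Qed.

Lemma le_cover_measure : {homo mu : A B / A `<=` B >-> A <= B}.
Proof.
move=> A B AB; apply/ereal_inf_le_tmp => _ [c Bc <-].
by exists c => //; exact: subset_trans AB Bc.
Qed.

Lemma cover_measure_sigma_subadditive : sigma_subadditive mu.
Proof.
move=> A; have [[i ioo]|] := pselect (exists i, mu (A i) = +oo).
  rewrite (eseries_pinfty _ _ ioo) ?leey// => n _.
  by rewrite -ltNye (lt_le_trans _ (cover_measure_ge0 _)).
rewrite -forallNE => Aoo.
suff add2e (e : {posnum R}) :
    mu (\bigcup_n A n) <= \sum_(i <oo) mu (A i) + e%:num%:E.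
  by apply/lee_addgt0Pr => _/posnumP[].
rewrite (le_trans _ (epsilon_trick _ _ _))//; last first.
  by move=> n; exact: cover_measure_ge0.
pose P n (c : nat -> option I) := A n `<=` \bigcup_k oapp S set0 (c k) /\
  \sum_(k <oo) oapp w 0 (c k) <= mu (A n) + (e%:num / (2 ^ n.+1)%:R)%:E.
have [G PG] : {G : nat -> nat -> option I & forall n, P n (G n)}.
  apply: (@choice _ _ P) => n; rewrite /P.
  have en1 : (0 < e%:num / (2 ^ n.+1)%:R :> R)%R by [].
  have Afin : mu (A n) \is a fin_num.
    by rewrite ge0_fin_numE ?cover_measure_ge0// ltey; apply/eqP/Aoo.
  have [_ [c Ac <-] /ltW lec] := lb_ereal_inf_adherent en1 Afin.
  by exists c.
pose W := oapp w 0 \o uncurry G.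
have W_ge0 x : 0 <= W x by exact: ow_ge0.
apply: (@le_trans _ _ (\esum_(i in setT) W i)).
  apply: ereal_inf_lbound => /=.
  have /card_esym/ppcard_eqP[f] := card_nat2.
  exists (uncurry G \o f) => /=.
    move=> t [n _ /(PG n).1[k _ Gt]]; exists (f^-1%FUN (n, k)) => //=.
    by rewrite invK ?inE.
  rewrite -(esum_pred_image W _ xpredT) ?[fun=> _]set_true//.
  by rewrite image_eq.
rewrite (_ : esum _ _ = \sum_(i <oo) \sum_(j <oo ) W (i, j)); last first.
  pose J : nat -> set (nat * nat) := fun i => [set (i, j) | j in setT].
  rewrite (_ : setT = \bigcup_k J k); last first.
    by rewrite predeqE => -[a b]; split => // _; exists a => //; exists b.
  rewrite esum_bigcupT /=; last 2 first.
    - apply/trivIsetP => i j _ _ ij.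
      rewrite predeqE => -[n m] /=; split => //= -[] [_] _ [<-{n} _].
      by move=> [m' _] [] /esym/eqP; rewrite (negbTE ij).
    - by move=> /= x; exact: W_ge0.
  rewrite -(image_id [set: nat]) -fun_true esum_pred_image//; last first.
    by move=> n _; exact: esum_ge0.
  apply: eq_eseriesr => /= j _.
  rewrite -(esum_pred_image W (pair j) predT)//=; last first.
    by move=> ? ? _ _; exact: (@can_inj _ _ _ snd).
  by congr esum; rewrite predeqE => -[a b]; split; move=> [i _ <-]; exists i.
apply: lee_lim.
- apply: is_cvg_nneseries => n *.
  by apply: nneseries_ge0 => m *; exact: (W_ge0 (n, m)).
- by apply: is_cvg_nneseries => n *; apply: adde_ge0 => //; exact: cover_measure_ge0.
- by near=> n; apply: lee_sum => i _; exact: (PG i).2.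
Unshelve. all: by end_near. Qed.

End cover_measure_theory.

Section lebesgue.
Context (R : realType) (n : nat).

Definition box (ab : 'rV[R]_n * 'rV[R]_n) : set 'rV[R]_n :=
  [set x | forall i, ab.1 ord0 i <= x ord0 i <= ab.2 ord0 i].

Definition box_volume (ab : 'rV[R]_n * 'rV[R]_n) : \bar R :=
  (\prod_i Num.max 0 (ab.2 ord0 i - ab.1 ord0 i))%:E.

Definition lebesgue_outer : set 'rV[R]_n -> \bar R :=
  cover_measure box box_volume.

Let box_volume_ge0 ab : (0 <= box_volume ab)%E.
Proof. by rewrite lee_fin; apply: prodr_ge0 => i _; rewrite le_max lexx. Qed.

HB.instance Definition _ := isOuterMeasure.Build R 'rV[R]_n lebesgue_outer
  (@cover_measure0 _ _ _ box _ box_volume_ge0)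
  (@cover_measure_ge0 _ _ _ box _ box_volume_ge0)
  (@le_cover_measure _ _ _ box box_volume)
  (@cover_measure_sigma_subadditive _ _ _ box _ box_volume_ge0).

(* n-dimensional Lebesgue measure, on the (complete) sigma-algebra of the
   Caratheodory-measurable sets *)
Definition volume :
    {measure set (caratheodory_type lebesgue_outer) -> \bar R} :=
  (lebesgue_outer : {outer_measure set 'rV[R]_n -> \bar R}).

End lebesgue.
Arguments volume {R n}.

Section hausdorff_measure.
Context (R : realType) (n : nat).
Local Open Scope ereal_scope.

Definition diameter (A : set 'rV[R]_n) : \bar R :=
  maxe 0 (ereal_sup [set (enorm (x - y))%:E | x in A & y in A]).

(* volume of a ball of diameter 1 of R^m; with this normalization the
   m-dimensional Hausdorff measure is the usual m-dimensional surface area *)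
Definition hausdorff_const (m : nat) : \bar R :=
  volume [set x : 'rV[R]_m | (enorm x <= 1)%R] * ((2 ^+ m)^-1)%:E.

Definition hausdorff_premeasure (m : nat) (delta : R) (A : set 'rV[R]_n) :=
  cover_measure (I := {B : set 'rV[R]_n | diameter B <= delta%:E})
    sval (fun B => hausdorff_const m * diameter (sval B) ^+ m) A.

Definition hausdorff_measure (m : nat) (A : set 'rV[R]_n) : \bar R :=
  ereal_sup [set hausdorff_premeasure m delta A | delta in
    [set delta : R | (0 < delta)%R]].

Definition boundary (A : set 'rV[R]_n) : set 'rV[R]_n :=
  closure A `\` interior A.

Definition surface_area (A : set 'rV[R]_n) : \bar R :=
  hausdorff_measure n.-1 (boundary A).

End hausdorff_measure.

Section torsion.
Context (R : realType) (n : nat).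
Implicit Types (Omega : set 'rV[R]_n) (u : 'rV[R]_n -> R).

Definition convex_domain Omega : Prop :=
  [/\ open Omega, Omega !=set0 & convex_set (Omega : set (convex_lmodType 'rV[R]_n))].

Definition partial (i : 'I_n) u : 'rV[R]_n -> R := 'D_(delta_mx ord0 i) u.

Definition gradient u (x : 'rV[R]_n) : 'rV[R]_n := \row_i partial i u x.

Definition laplacian u (x : 'rV[R]_n) : R := \sum_i partial i (partial i u) x.

Definition C2_on Omega u : Prop := forall x, Omega x -> forall i j,
  [/\ derivable u x (delta_mx ord0 i), {for x, continuous (partial i u)},
      derivable (partial i u) x (delta_mx ord0 j) &
      {for x, continuous (partial j (partial i u))}].

Definition torsion_function Omega u : Prop :=
  [/\ {within closure Omega, continuous u}, C2_on Omega u,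
      forall x, Omega x -> - laplacian u x = 1 &
      forall x, boundary Omega x -> u x = 0].

(* the L^oo(Omega) norm is that of the extension by 0 outside of Omega *)
Definition gradient_sup_norm Omega u : \bar R :=
  Lnorm volume +oo%E
    ((fun x => (enorm (gradient u x))%:E) \_ Omega).

End torsion.

Definition hausdorff_dist (R : realType) (n : nat) (A B : set 'rV[R]_n) : \bar R :=
  (maxe (ereal_sup [set ereal_inf [set (enorm (a - b))%:E | b in B] | a in A])
        (ereal_sup [set ereal_inf [set (enorm (a - b))%:E | a in A] | b in B]))%E.

Definition translate (R : realType) (n : nat) (v : 'rV[R]_n) (A : set 'rV[R]_n) :
  set 'rV[R]_n := [set v + x | x in A].

(* Main.v *)
Require Import Defs.
From mathcomp Require Import all_boot all_order all_algebra.
From mathcomp Require Import all_classical all_reals all_analysis.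
From mathcomp Require Import perm measurable_realfun.
From mathcomp Require Import ring lra.

(** Let [2 h] be, up to a constant, the minimal width of a convex domain of volume
1. A simplex of almost maximal volume shows that the domain lies in a slab of
half-width [h] while containing a cube of radius comparable to [h]. The surface
area is then comparable to [1 / h]: the boundary lies in a shell between two
homothetic copies of the domain, which bounds the area from above, and each point
of the domain can be moved to the boundary by a fraction of a fixed vector of
length of order [h], which bounds it from below. Barriers of one variable give
[u <= h^2 / 2] and [u <= h s] for the distance [s] to a supporting hyperplane;
since the difference of two translates of [u] is harmonic, the maximum principle
turns the latter into [|grad u| = O(h)]. Hence the product in the theorem is
[O(h^(1 - p))] with [p = (alpha - 1) / (d - 1) < 1], so that [h] is bounded from
below, and a convex set of volume 1 containing a cube of fixed size has bounded
diameter. The convergent subsequence is Blaschke's selection theorem, whose limit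
is the set of the points with a neighbourhood contained in ultrafilter-many of
the domains. *)

Set Implicit Arguments.
Unset Strict Implicit.
Unset Printing Implicit Defensive.

Import Order.TTheory GRing.Theory Num.Theory.
Import numFieldNormedType.Exports.

Local Open Scope classical_set_scope.
Local Open Scope ring_scope.

(** * Lebesgue outer measure *)

Section box_cover.
Variable R : realType.

(** Only powers of [h] matter, so factors depending on the dimension are given away freely. Closed
    cubes of the sup norm can then do all the measure theory: volumes are compared through packings
    and covers by cubes, and convexity enters mostly through one quantitative fact, that a cone over
    a cube contained in the domain stays in the domain.

    The surface area is needed from both sides because [p] is negative when [alpha < 1], and then a
    large area makes the product small. The gradient is needed only from above.

    The obstacle for the gradient is the boundary: [u] is continuous up to it but is not assumed to
    be differentiable there, so the maximum principle cannot be applied to the derivatives of [u].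
    Applied to a difference of translates, it asks for continuity up to the boundary only, and the
    bound [h s] controls this difference on the boundary of the intersection of the two translated
    domains. *)

Definition vol n (a b : 'I_n -> R) : R := \prod_i Num.max 0 (b i - a i).

Lemma vol_ge0 n (a b : 'I_n -> R) : 0 <= vol a b.
Proof. by apply: prodr_ge0 => i _; rewrite le_max lexx. Qed.

(** Induction on the dimension by slicing: for each value [t] of the first coordinate, the boxes
    that meet the slice cover a box of one dimension less, and integrating over [t] restores the
    missing side. The selection [P] lets the induction discard the boxes that miss the slice. *)
Lemma box_cover n (a b : 'I_n -> R) (P : nat -> bool)
    (l u : nat -> 'I_n -> R) :
  (forall x, (forall i, a i <= x i <= b i) ->
     exists2 k, P k & forall i, l k i <= x i <= u k i) ->
  ((vol a b)%:E <= \sum_(k <oo) (if P k then vol (l k) (u k) else 0)%:E)%E.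
Proof.
elim: n a b P l u => [|n IHn] a b P l u H.
  (* In dimension 0 every volume is the empty product 1, so one selected box suffices. *)
  have [|k Pk _] := H (fun=> 0); first by case.
  have F0 j : (0 <= (if P j then vol (l j) (u j) else 0)%:E :> \bar R)%E.
    by rewrite lee_fin; case: ifP => // _; exact: vol_ge0.
  apply: le_trans (nneseries_lim_ge k.+1 _) => [|j _ _]; last exact: F0.
  rewrite big_nat_recr//= Pk /vol !big_ord0 leeDr//.
  by apply: sume_ge0 => j _; exact: F0.
pose tl (c : 'I_n.+1 -> R) (j : 'I_n) := c (lift ord0 j).
have volS (c e : 'I_n.+1 -> R) :
    vol c e = Num.max 0 (e ord0 - c ord0) * vol (tl c) (tl e).
  by rewrite /vol big_ord_recl.
have [ba|ab] := ltP (b ord0) (a ord0).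
  rewrite volS max_l ?mul0r; last lra.
  apply: nneseries_ge0 => j _ _.
  by rewrite lee_fin; case: ifP => // _; exact: vol_ge0.
pose mu := @lebesgue_measure R.
pose M k := if P k then vol (tl (l k)) (tl (u k)) else 0.
have M0 k : 0 <= M k by rewrite /M; case: ifP => // _; exact: vol_ge0.
pose I k : set R := `[l k ord0, u k ord0]%classic.
pose f k (t : R) := ((M k)%:E * (\1_(I k) t)%:E)%E.
have mf k : measurable_fun setT (f k).
  apply: measurable_funeM; apply/measurable_EFinP.
  by apply: measurable_indic; exact: measurable_itv.
have slice t : `[a ord0, b ord0]%classic t ->
    ((vol (tl a) (tl b))%:E <= \sum_(k <oo) f k t)%E.
  rewrite /= in_itv /= => tab.
  pose P' k := P k && (l k ord0 <= t <= u k ord0).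
  have := IHn (tl a) (tl b) P' (fun k => tl (l k)) (fun k => tl (u k)).
  move=> /(_ _)/le_trans; apply.
    move=> y yab.
    pose x i := if unlift ord0 i is Some j then y j else t.
    have [i|k Pk xk] := H x.
      rewrite /x; case: (unliftP ord0 i) => [j|] ->; [exact: yab|exact: tab].
    exists k => [|j]; last by have := xk (lift ord0 j); rewrite /x liftK.
    by rewrite /P' Pk /=; have := xk ord0; rewrite /x unlift_none.
  apply: lee_nneseries => [k _ _|k _].
    by rewrite lee_fin; case: ifP => // _; exact: vol_ge0.
  rewrite /f /M /P' indicE; case: (P k) => /=; last by rewrite mul0e.
  case: ifPn => tk; last by rewrite -EFinM lee_fin mulr_ge0// vol_ge0.
  by rewrite mem_set ?mule1//= in_itv.
have mD : measurable (`[a ord0, b ord0]%classic : set R) by exact: measurable_itv.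
have f0 k t : (0 <= f k t)%E by apply: mule_ge0; rewrite lee_fin.
have /(_ _) := @ge0_le_integral _ _ R mu _ mD
   (fun=> (vol (tl a) (tl b))%:E) (fun t => \sum_(k <oo) f k t)%E.
move=> /(_ (fun _ _ => vol_ge0 _ _)) /=.
move=> /(_ (measurable_cst _)) /(_ _ slice).
have ms : measurable_fun `[a ord0, b ord0]%classic
    (fun t : R => \sum_(k <oo) f k t)%E.
  apply: (measurable_funS measurableT) => //.
  by apply: ge0_emeasurable_sum => // k t _ _; exact: f0.
move=> /(_ ms).
rewrite integral_cst// integral_nneseries//; last first.
  by move=> k; exact: (measurable_funS measurableT (@subsetT _ _) (mf k)).
have muI (x y : R) : mu `[x, y]%classic = (Num.max 0 (y - x))%:E.
  rewrite /mu lebesgue_measure_itv/= lte_fin; case: ltP => xy.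
    by rewrite -EFinB max_r//; lra.
  by rewrite max_l//; lra.
rewrite [X in (_ * X)%E]muI -EFinM mulrC -volS => /le_trans; apply.
apply: lee_nneseries => [k _ _|k _].
  by apply: integral_ge0 => t _; exact: f0.
rewrite /f ge0_integralZl//; last 2 first.
- apply/measurable_EFinP; apply: (measurable_funS measurableT) => //.
  by apply: measurable_indic; exact: measurable_itv.
- by rewrite lee_fin.
rewrite integral_indic//; last exact: measurable_itv.
apply: (@le_trans _ _ ((M k)%:E * mu (I k))%E).
  apply: lee_wpmul2l; first by rewrite lee_fin.
  have mI : measurable (I k) by exact: measurable_itv.
  apply: le_measure; rewrite ?inE.
  - exact: measurableI.
  - exact: mI.
  - exact: subIsetl.
rewrite [mu (I k)]muI /M; case: ifP => _; last by rewrite mul0e.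
by rewrite -EFinM lee_fin volS mulrC.
Qed.

End box_cover.

Section sup_norm.
Variables (R : realType) (n : nat).
Implicit Types x y : 'rV[R]_n.

Lemma norm_coord_le x (r : R) : 0 <= r ->
  (`|x| <= r) <-> (forall i, `|x ord0 i| <= r).
Proof.
move=> r0; rewrite [`|x|]mx_normrE; split => [xr i|xr].
  by apply: le_trans xr; rewrite (le_bigmax _ _ (ord0, i)).
by apply/bigmax_leP; split => // -[i j] _ /=; rewrite ord1.
Qed.

Lemma norm_coord x i : `|x ord0 i| <= `|x|.
Proof. exact: (norm_coord_le _ (normr_ge0 x)).1. Qed.

(** Closed balls of the sup norm: they are boxes, hence measurable with an explicit volume, and they
    also form a basis of neighbourhoods. *)
Definition cube x (r : R) : set 'rV[R]_n := [set y | `|y - x| <= r].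

Lemma cubeE x r : 0 <= r -> cube x r = box (x - const_mx r, x + const_mx r).
Proof.
move=> r0; apply/seteqP; split => y /=.
  by move/(norm_coord_le _ r0) => h i; have := h i; rewrite !mxE ler_distl.
by move=> h; apply/(norm_coord_le _ r0) => i; have := h i; rewrite !mxE ler_distl.
Qed.

End sup_norm.

Section lebesgue_outer_theory.
Variables (R : realType) (n : nat).
Implicit Types (A S T : set 'rV[R]_n).
Local Notation V := 'rV[R]_n.
Local Notation mu := (@lebesgue_outer R n).

Lemma box_volumeE (p : V * V) :
  box_volume p = (vol (fun i => p.1 ord0 i) (fun i => p.2 ord0 i))%:E.
Proof. by []. Qed.

Lemma box_volume_ge0 (p : V * V) : (0 <= box_volume p)%E.
Proof. by rewrite box_volumeE lee_fin vol_ge0. Qed.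

Lemma oapp_box_volume_ge0 (o : option (V * V)) : (0 <= oapp (@box_volume R n) 0 o)%E.
Proof. by case: o => //= p; exact: box_volume_ge0. Qed.

Lemma lebesgue_outer_box p : mu (box p) = box_volume p.
Proof.
apply/eqP; rewrite eq_le; apply/andP; split.
  apply: ereal_inf_lbound; exists (fun k => if k == 0%N then Some p else None).
    by move=> x px; exists 0%N.
  rewrite (nneseries_split 0 1) ?add0n => [|k _]; last exact: oapp_box_volume_ge0.
  rewrite big_nat1 /= eseries0 ?adde0// => i i1 _.
  by case: i i1.
apply: le_ereal_inf_tmp => _ [c pc <-].
pose lo k i := (odflt (0, 0) (c k)).1 ord0 i.
pose hi k i := (odflt (0, 0) (c k)).2 ord0 i.
rewrite box_volumeE.
apply: le_trans (@box_cover _ _ _ _ (fun k => isSome (c k)) lo hi _) _.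
  move=> x px; have [|k _] := pc (\row_i x i).
    by move=> i; rewrite mxE.
  rewrite /lo /hi; case ck : (c k) => [q|]//= xq.
  by exists k; rewrite ck//= => i; have := xq i; rewrite mxE.
apply: lee_nneseries => [k _ _|k _].
  by rewrite lee_fin; case: ifP => // _; exact: vol_ge0.
by rewrite /lo /hi; case: (c k).
Qed.

Lemma lebesgue_outer_cube (x : V) r : 0 <= r -> mu (cube x r) = ((2 * r) ^+ n)%:E.
Proof.
move=> r0; rewrite cubeE// lebesgue_outer_box; congr EFin.
rewrite (eq_bigr (fun=> 2 * r)) ?prodr_const ?card_ord// => i _.
by rewrite !mxE /= max_r; lra.
Qed.

Lemma le_lebesgue_outer A S : A `<=` S -> (mu A <= mu S)%E.
Proof. exact: le_cover_measure. Qed.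

Definition upd (x : V) i (t : R) : V := \row_j if j == i then t else x ord0 j.

(** The hyperplane cuts each box of a cover into two boxes whose volumes add up. The two inclusions
    leave open to which side the hyperplane itself belongs, so that open and closed half-spaces are
    treated together. *)
Lemma half_space_caratheodory (i : 'I_n) (a : R) (H : set V) :
  H `<=` [set x | x ord0 i <= a] -> ~` H `<=` [set x | a <= x ord0 i] ->
  mu.-caratheodory H.
Proof.
move=> Ha Hca; apply: (@le_caratheodory_measurable _ _ mu H) => X.
apply: le_ereal_inf_tmp => _ [c Xc <-].
pose f (p : V * V) := (p.1, upd p.2 i (Num.min (p.2 ord0 i) a)).
pose g (p : V * V) := (upd p.1 i (Num.max (p.1 ord0 i) a), p.2).
apply: (@le_trans _ _ (\sum_(k <oo) oapp (@box_volume R n) 0 (omap f (c k)) +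
   \sum_(k <oo) oapp (@box_volume R n) 0 (omap g (c k))))%E.
  apply: leeD; apply: ereal_inf_lbound.
    exists (fun k => omap f (c k)) => //.
    move=> x [Xx /Ha /= xa]; have [k _] := Xc _ Xx.
    case ck : (c k) => [p|]//= xp; exists k => //; rewrite ck /= => j.
    have := xp j; rewrite mxE; case: eqP => [->|//] /andP[-> xp2].
    by rewrite le_min xp2 xa.
  exists (fun k => omap g (c k)) => //.
  move=> x [Xx /Hca /= xa]; have [k _] := Xc _ Xx.
  case ck : (c k) => [p|]//= xp; exists k => //; rewrite ck /= => j.
  have := xp j; rewrite mxE; case: eqP => [->|//] /andP[xp1 ->].
  by rewrite ge_max xp1 xa.
rewrite -nneseriesD; [|by move=> *; exact: oapp_box_volume_ge0..].
apply: lee_nneseries => [k _ _|k _].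
  by apply: adde_ge0; exact: oapp_box_volume_ge0.
case: (c k) => [p|]/=; last by rewrite adde0.
rewrite /box_volume -EFinD lee_fin.
rewrite (bigD1 i)//= [X in _ + X](bigD1 i)//= [leRHS](bigD1 i)//= !mxE eqxx.
have E q : (forall j, j != i -> q j = Num.max 0 (p.2 ord0 j - p.1 ord0 j)) ->
    \prod_(j < n | j != i) q j =
    \prod_(j < n | j != i) Num.max 0 (p.2 ord0 j - p.1 ord0 j).
  by move=> Eq; apply: eq_bigr => j; exact: Eq.
rewrite E; last by move=> j /negPf ji; rewrite mxE ji.
rewrite E; last by move=> j /negPf ji; rewrite mxE ji.
rewrite -mulrDl ler_wpM2r//.
  by apply: prodr_ge0 => j _; rewrite le_max lexx.
case: (leP (p.2 ord0 i) a) => h1; case: (leP (p.1 ord0 i) a) => h2.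
- rewrite [X in _ + X]max_l; lra.
- rewrite [X in _ + X]max_l; lra.
- by rewrite !max_r; lra.
- by rewrite [X in X + _]max_l; lra.
Qed.

Lemma box_caratheodory p : mu.-caratheodory (box p).
Proof.
pose lo i : set (caratheodory_type mu) := ~` [set x : V | x ord0 i < p.1 ord0 i].
pose hi i : set (caratheodory_type mu) := [set x : V | x ord0 i <= p.2 ord0 i].
have -> : box p = \bigcap_(i in [set: 'I_n]) (lo i `&` hi i).
  apply/seteqP; split => [x px i _|x px i].
    by have /andP[p1 p2] := px i; split => //=; apply/negP; rewrite -leNgt.
  by have [/negP/=] := px i I; rewrite -leNgt => -> ->.
suff : measurable (\bigcap_(i in [set: 'I_n]) (lo i `&` hi i)) by [].
apply: fin_bigcap_measurable => // i _.
apply: measurableI.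
  apply: measurableC; apply: (@half_space_caratheodory i (p.1 ord0 i)).
    by move=> x /= /ltW.
  by move=> x /= /negP; rewrite -leNgt.
apply: (@half_space_caratheodory i (p.2 ord0 i)) => // x /= /negP.
by rewrite -ltNge => /ltW.
Qed.

Lemma cube_caratheodory x r : 0 <= r -> mu.-caratheodory (cube x r).
Proof. by move=> r0; rewrite cubeE//; exact: box_caratheodory. Qed.

Lemma packing S T (s : seq V) r : 0 <= r -> T `<=` S ->
  (forall c, c \in s -> cube c r `<=` S) ->
  (forall c, c \in s -> cube c r `&` T = set0) ->
  pairwise (fun c c' : V => 2 * r < `|c - c'|) s ->
  (((size s)%:R * (2 * r) ^+ n)%:E + mu T <= mu S)%E.
Proof.
move=> r0; elim: s S => [|c s IHs] S TS sS sT.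
  by move=> _; rewrite mul0r add0e le_lebesgue_outer.
rewrite pairwise_cons => /andP[/allP cs ps].
have cS : cube c r `<=` S by apply: sS; rewrite mem_head.
have cT : cube c r `&` T = set0 by apply: sT; rewrite mem_head.
rewrite (@cube_caratheodory c r r0 S) setIC (setIidl cS) lebesgue_outer_cube//.
rewrite [size (c :: s)]/= -[(size s).+1%:R]natr1 mulrDl mul1r EFinD addeAC addeC leeD2l//.
apply: IHs => // [x Tx|c' c's x cx|c' c's].
- split; first exact: TS.
  by move=> cx; rewrite -[False]/(set0 x) -cT.
- split; first by apply: (sS c') => //; rewrite inE c's orbT.
  move=> /= cx'; have := cs _ c's; apply/negP; rewrite -leNgt.
  rewrite -(subrKA x) (le_trans (ler_normD _ _))// mulr_natl mulr2n lerD//.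
  by rewrite distrC.
- by apply: sT; rewrite inE c's orbT.
Qed.

(** The image of a cover is a cover. The reverse inequality is obtained where needed by using the
    inverse map. *)
Lemma lebesgue_outer_affine (c : V) (t : R) A : 0 < t ->
  (mu [set (c + t *: x)%R | x in A] <= (t ^+ n)%:E * mu A)%E.
Proof.
move=> t0; have tn0 : 0 < t ^+ n by rewrite exprn_gt0.
rewrite -lee_pdivrMl//; apply: le_ereal_inf_tmp => _ [b Ab <-].
rewrite lee_pdivrMl// -nneseriesZl; last by move=> *; exact: oapp_box_volume_ge0.
pose f (p : V * V) := (c + t *: p.1, c + t *: p.2).
apply: ereal_inf_lbound; exists (fun k => omap f (b k)).
  move=> _ [x Ax <-]; have [k _] := Ab _ Ax.
  case bk : (b k) => [p|]//= xp; exists k => //; rewrite bk /= => i.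
  by have := xp i; rewrite !mxE !lerD2l !ler_pM2l.
apply: eq_eseriesr => k _; case: (b k) => [p|]/=; last by rewrite mule0.
rewrite /box_volume /= -EFinM; congr EFin.
have -> : t ^+ n = \prod_(i < n) t by rewrite prodr_const card_ord.
rewrite -big_split; apply: eq_bigr => i _ /=.
rewrite !mxE opprD addrACA subrr add0r -mulrBr.
by rewrite maxr_pMr ?mulr0 ?ltW.
Qed.

End lebesgue_outer_theory.

(** * Convex sets and the Euclidean norm *)

Section convex_geometry.
Variables (R : realType) (n : nat).
Local Notation V := 'rV[R]_n.
Implicit Types (A Om : set V) (x y z v w : V).

Definition convex A := forall x y (t : R), A x -> A y -> 0 <= t <= 1 ->
  A (t *: x + (1 - t) *: y).

Lemma convex_setP A : convex_set (A : set (convex_lmodType V)) <-> convex A.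
Proof.
split=> [cA x y t Ax Ay /andP[t0 t1]|cA x y l].
  have := cA x y (Itv01 t0 t1); rewrite !inE => /(_ Ax Ay).
  by [].
rewrite !inE => Ax Ay.
by apply: (cA x y l%:num) => //; rewrite ge0 le1.
Qed.

Lemma nbhs_cubeP A x : nbhs x A <-> exists2 r : R, 0 < r & cube x r `<=` A.
Proof.
split=> [/nbhs_ballP[e /= e0 eA]|[r r0 rA]].
  exists (e / 2) => [|y]; first lra.
  by rewrite /cube /= => xy; apply: eA; rewrite -ball_normE /= distrC; lra.
apply/nbhs_ballP; exists r => //= y; rewrite -ball_normE /= => xy.
by apply: rA; rewrite /cube /= distrC ltW.
Qed.

Lemma closure_normP A x :
  closure A x <-> forall e : R, 0 < e -> exists2 y, A y & `|x - y| < e.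
Proof.
split=> [clA e e0|H B /nbhs_ballP[e /= e0 eB]].
  have [y []] := clA _ (nbhsx_ballx x e e0).
  by rewrite -ball_normE /= => Ay xy; exists y.
have [y Ay xy] := H e e0.
by exists y; split => //; apply: eB; rewrite -ball_normE.
Qed.

Lemma open_cube A x : open A -> A x -> exists2 r : R, 0 < r & cube x r `<=` A.
Proof. by move=> oA Ax; apply/nbhs_cubeP; exact: open_nbhs_nbhs. Qed.

Lemma openP A : open A <->
  forall x, A x -> exists2 r : R, 0 < r & cube x r `<=` A.
Proof.
split=> [oA x|H]; first exact: open_cube.
by rewrite openE => x /H; rewrite /interior => /nbhs_cubeP.
Qed.

Lemma boundaryP A x : open A -> boundary A x <-> closure A x /\ ~ A x.
Proof.
move=> oA; split=> -[clA iA]; split => // Ax; apply: iA.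
  exact: open_nbhs_nbhs.
exact: interior_subset Ax.
Qed.

Lemma cube_center Om x0 (r : R) : 0 <= r -> cube x0 r `<=` Om -> Om x0.
Proof. by move=> r0; apply; rewrite /cube /= subrr normr0. Qed.

(** The homothety of centre [y] and ratio [s] maps the cube at [x0] onto the cube of radius [s * r]
    at the point [(1 - s) *: y + s *: x0]. *)
Lemma convex_cube Om x0 (r : R) (cOm : convex Om) (r0 : 0 < r)
    (rOm : cube x0 r `<=` Om) x y (s : R) : Om y -> 0 < s <= 1 ->
  `|x - ((1 - s) *: y + s *: x0)| <= s * r -> Om x.
Proof.
move=> Oy /andP[s0 s1] xsr.
have -> : x = s *: (x0 + s^-1 *: (x - ((1 - s) *: y + s *: x0))) + (1 - s) *: y.
  by apply/rowP => i; rewrite !mxE; field; rewrite gt_eqF.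
apply: cOm => //; last by rewrite ltW.
apply: rOm; rewrite /cube /= addrC addKr normrZ gtr0_norm ?invr_gt0//.
by rewrite mulrC ler_pdivrMr// mulrC.
Qed.

(** The strict inequality leaves room to replace [y] by a nearby point of [Om]. *)
Lemma convex_closure_cube Om x0 (r : R) (cOm : convex Om) (r0 : 0 < r)
    (rOm : cube x0 r `<=` Om) x y (s : R) : closure Om y -> 0 < s <= 1 ->
  `|x - ((1 - s) *: y + s *: x0)| < s * r -> Om x.
Proof.
move=> /closure_normP cy s01 xsr.
have [|y' Oy' yy'] := cy (s * r - `|x - ((1 - s) *: y + s *: x0)|).
  by rewrite subr_gt0.
apply: (convex_cube cOm r0 rOm (y := y') (s := s)) => //.
have -> : x - ((1 - s) *: y' + s *: x0) =
    (x - ((1 - s) *: y + s *: x0)) + (1 - s) *: (y - y').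
  by apply/rowP => i; rewrite !mxE; ring.
apply: le_trans (ler_normD _ _) _.
have /andP[s0 s1] := s01.
have : `|(1 - s) *: (y - y')| <= `|y - y'|.
  rewrite normrZ ger0_norm; last lra.
  by rewrite ler_piMl//; lra.
lra.
Qed.

(* Half of a cone over a cube contains about [D / r] disjoint cubes. *)
Lemma convex_diameter Om x0 (r : R) (cOm : convex Om) (r0 : 0 < r)
    (rOm : cube x0 r `<=` Om) y : (lebesgue_outer Om <= 1)%E -> Om y ->
  `|y - x0| <= 4 * r / r ^+ n.
Proof.
move=> vOm Oy; set D := `|y - x0|.
have [->|D0] := eqVneq D 0.
  by rewrite divr_ge0// ?exprn_ge0 ?mulr_ge0 ?ltW.
have {}D0 : 0 < D by rewrite lt_def D0 normr_ge0.
pose N := Num.truncn (D / (4 * r)).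
have /andP[N1 N2] : N%:R <= D / (4 * r) < N.+1%:R.
  by apply: truncn_itv; rewrite divr_ge0 ?mulr_ge0 ?ltW.
rewrite ler_pdivlMr in N1; last lra.
rewrite ltr_pdivrMr in N2; last lra.
(* The points [z k] are spaced by [2 * r] on the first half of the segment from [x0] to [y], where
   the cone still contains cubes of radius [r / 2]. *)
pose t k : R := k%:R * (2 * r / D).
have tN k : (k <= N)%N -> 0 <= t k <= 1 / 2.
  move=> kN; apply/andP; split.
    by rewrite mulr_ge0//; rewrite divr_ge0 ?mulr_ge0 ?ltW.
  have : k%:R <= N%:R :> R by rewrite ler_nat.
  rewrite /t mulrA ler_pdivrMr// => kN'.
  have := ler_wpM2r (ltW r0) kN'; lra.
pose z k := x0 + t k *: (y - x0).
have := @packing R n Om set0 [seq z k | k <- iota 0 N.+1] (r / 2).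
rewrite size_map size_iota.
have -> : 2 * (r / 2) = r by field.
have mu0 : lebesgue_outer (set0 : set V) = 0%E by exact: cover_measure0 (@box_volume_ge0 R n).
rewrite mu0 adde0 => /(_ _ _ _ _ _)/le_trans /(_ vOm).
rewrite lee_fin -ler_pdivlMr ?exprn_gt0// mul1r => H.
have {H} : N.+1%:R <= (r ^+ n)^-1.
  apply: H => [||c /mapP[k]|c _|]; first lra.
  - exact: sub0set.
  - rewrite mem_iota /= add0n ltnS => /tN tk -> x; rewrite /cube /= => xz.
    apply: (convex_cube cOm r0 rOm (y := y) (s := 1 - t k)) => //; first lra.
    have -> : (1 - (1 - t k)) *: y + (1 - t k) *: x0 = z k.
      by apply/rowP => i; rewrite !mxE; ring.
    apply: le_trans xz _.
    have : (1 / 2) * r <= (1 - t k) * r by rewrite ler_wpM2r//; lra.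
    lra.
  - by rewrite setI0.
  - apply/(pairwiseP (0 : V)) => i j; rewrite !inE size_map size_iota => iN jN ij.
    rewrite !(nth_map 0%N) ?size_iota// !nth_iota// !add0n.
    have -> : z i - z j = (t i - t j) *: (y - x0).
      by apply/rowP => l; rewrite !mxE; ring.
    rewrite normrZ /t -mulrBl normrM -/D [`|_ / D|]ger0_norm; last first.
      by rewrite divr_ge0 ?mulr_ge0 ?ltW.
    rewrite -mulrA divfK ?gt_eqF// distrC ger0_norm; last first.
      by rewrite subr_ge0 ler_nat ltnW.
    have : 1 <= j%:R - i%:R :> R.
      by rewrite -natrB ?ler1n ?subn_gt0// ltnW.
    move/(ler_wpM2r (ltW r0)); lra.
move=> H; have : D <= N.+1%:R * (4 * r) by rewrite ltW.
move/le_trans; apply; rewrite mulrC ler_wpM2l//; lra.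
Qed.

(** The weight missing to 1 is put on [p]. *)
Lemma convex_comb Om (p : V) (s : seq (R * V)) : convex Om -> Om p ->
  (forall q, q \in s -> 0 <= q.1 /\ Om (p + q.2)) ->
  \sum_(q <- s) q.1 <= 1 -> Om (p + \sum_(q <- s) q.1 *: q.2).
Proof.
move=> cOm Op sOm; set c := \sum_(q <- s) q.1 => c1.
(* Normalised form of the sum, suited to induction: [u] is the weighted mean, or an arbitrary
   admissible vector when all the weights vanish. *)
suff [c0 [u Ou ->]] : 0 <= c /\
    exists2 u, Om (p + u) & \sum_(q <- s) q.1 *: q.2 = c *: u.
  have -> : p + c *: u = c *: (p + u) + (1 - c) *: p.
    by apply/rowP => i; rewrite !mxE; ring.
  by apply: cOm => //; rewrite c0.
rewrite /c {c c1}; elim: s sOm => [|[t v] s IHs] sOm.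
  by rewrite !big_nil; split => //; exists 0; rewrite ?addr0// scaler0.
have [|c0 [u Ou E]] := IHs.
  by move=> q qs; apply: sOm; rewrite inE qs orbT.
have /= [t0 Ov] := sOm (t, v) (mem_head _ _).
rewrite !big_cons /= E; set c := \sum_(q <- s) q.1 in c0 E *.
split; first exact: addr_ge0.
have [tc0|tc0] := eqVneq (t + c) 0.
  exists u => //; have [-> ->] : t = 0 /\ c = 0 by split; lra.
  by rewrite !scale0r !addr0 scale0r.
have tc : 0 < t + c by rewrite lt_def tc0 addr_ge0.
exists ((t / (t + c)) *: v + (1 - t / (t + c)) *: u).
  have -> : p + (t / (t + c) *: v + (1 - t / (t + c)) *: u) =
     (t / (t + c)) *: (p + v) + (1 - t / (t + c)) *: (p + u).
    by apply/rowP => i; rewrite !mxE; ring.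
  apply: cOm => //; apply/andP; split; first by apply: divr_ge0 => //; rewrite ltW.
  by rewrite ler_pdivrMr// mul1r lerDl.
by apply/rowP => i; rewrite !mxE; field.
Qed.

Definition dot x y : R := \sum_i x ord0 i * y ord0 i.

Lemma dotDr x y z : dot x (y + z) = dot x y + dot x z.
Proof. by rewrite -big_split; apply: eq_bigr => i _; rewrite mxE mulrDr. Qed.

Lemma dotZr x y (t : R) : dot x (t *: y) = t * dot x y.
Proof. by rewrite mulr_sumr; apply: eq_bigr => i _; rewrite mxE; ring. Qed.

Lemma dotC x y : dot x y = dot y x.
Proof. by apply: eq_bigr => i _; rewrite mulrC. Qed.

Lemma dotZl x y (t : R) : dot (t *: x) y = t * dot x y.
Proof. by rewrite dotC dotZr dotC. Qed.

Lemma dotDl x y z : dot (x + y) z = dot x z + dot y z.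
Proof. by rewrite dotC dotDr !(dotC z). Qed.

Lemma dotNr x y : dot x (- y) = - dot x y.
Proof. by rewrite -scaleN1r dotZr mulN1r. Qed.

Lemma dotBr x y z : dot x (y - z) = dot x y - dot x z.
Proof. by rewrite dotDr dotNr. Qed.

Lemma enormE x : enorm x = Num.sqrt (dot x x).
Proof. by congr Num.sqrt; apply: eq_bigr => i _; rewrite expr2. Qed.

Lemma dot_ge0 x : 0 <= dot x x.
Proof. by apply: sumr_ge0 => i _; rewrite -expr2 sqr_ge0. Qed.

Lemma enorm_ge0 x : 0 <= enorm x.
Proof. exact: sqrtr_ge0. Qed.

Lemma sqr_enorm x : enorm x ^+ 2 = dot x x.
Proof. by rewrite enormE sqr_sqrtr// dot_ge0. Qed.

Lemma coord_le_enorm x i : `|x ord0 i| <= enorm x.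
Proof.
rewrite enormE -sqrtr_sqr ler_sqrt ?dot_ge0// /dot (bigD1 i)//= -expr2 lerDl.
by apply: sumr_ge0 => j _; rewrite -expr2 sqr_ge0.
Qed.

Lemma norm_le_enorm x : `|x| <= enorm x.
Proof. by apply/(norm_coord_le _ (enorm_ge0 x)) => i; exact: coord_le_enorm. Qed.

Lemma dot_le_norm x y : `|dot x y| <= n%:R * enorm x * `|y|.
Proof.
apply: le_trans (ler_norm_sum _ _ _) _.
apply: (@le_trans _ _ (\sum_(i < n) enorm x * `|y|)).
  by apply: ler_sum => i _; rewrite normrM ler_pM// ?coord_le_enorm// norm_coord.
by rewrite sumr_const card_ord -mulrA mulr_natl.
Qed.

Lemma enorm_le_norm x : enorm x <= n%:R * `|x|.
Proof.
have [x0|x0] := eqVneq (enorm x) 0; first by rewrite x0 mulr_ge0.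
have {}x0 : 0 < enorm x by rewrite lt_def x0 enorm_ge0.
have := dot_le_norm x x; rewrite -sqr_enorm ger0_norm ?sqr_ge0// expr2.
by rewrite -[_ * _ * `|x|]mulrA mulrCA ler_pM2l.
Qed.

Lemma enorm_gt0 x : x != 0 -> 0 < enorm x.
Proof. by rewrite -normr_gt0 => /lt_le_trans; apply; exact: norm_le_enorm. Qed.

End convex_geometry.

(** * Slabs, separation and boundaries *)

Section slab.
Variable R : realType.

Definition row_subst n (A : 'M[R]_n) (i : 'I_n) (y : 'rV[R]_n) : 'M[R]_n :=
  \matrix_(k, l) if k == i then y ord0 l else A k l.

(** Cramer's rule: divided by [\det A], the right-hand side is the [i]-th coordinate of [y] in the
    basis of the rows of [A]. *)
Lemma det_row_subst n (A : 'M[R]_n) i y :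
  \det (row_subst A i y) = (y *m \adj A) ord0 i.
Proof.
rewrite (expand_det_row _ i) mxE; apply: eq_bigr => j _; rewrite !mxE eqxx.
congr (_ * (_ * \det _)); apply/matrixP => k l; rewrite !mxE.
by rewrite eq_sym (negPf (neq_lift i k)).
Qed.

Lemma row_row_subst n (A : 'M[R]_n) i y k :
  row k (row_subst A i y) = if k == i then y else row k A.
Proof. by apply/rowP => l; rewrite !mxE; case: ifP => //; rewrite !mxE. Qed.

(** A crude Leibniz bound, sufficient to make a supremum of determinants finite. *)
Lemma det_le n (A : 'M[R]_n) (D : R) : (forall i, `|row i A| <= D) ->
  `|\det A| <= \sum_(s : 'S_n) D ^+ n.
Proof.
move=> AD; apply: le_trans (ler_norm_sum _ _ _) _.
apply: ler_sum => s _; rewrite normrM normrX normrN1 expr1n mul1r normr_prod.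
have -> : D ^+ n = \prod_(i < n) D by rewrite prodr_const card_ord.
apply: ler_prod => i _; rewrite normr_ge0 /=.
by apply: le_trans (AD i); have := norm_coord (row i A) (s i); rewrite mxE.
Qed.

(* The rows of a matrix of almost maximal determinant among those whose rows
   point from [p0] into [Om] span a simplex which is, by Cramer's rule, within a
   constant factor of [Om]. *)
Lemma convex_slab n (Om : set 'rV[R]_n) p0 (D : R) : (0 < n)%N ->
  convex Om -> open Om -> Om p0 -> (forall x, Om x -> `|x - p0| <= D) ->
  exists w q, [/\ w != 0, forall x, Om x -> `|dot w (x - p0)| <= 2 &
    cube q (2 * n%:R ^+ 2 * enorm w)^-1 `<=` Om].
Proof.
move=> n0 cOm oOm Op0 OmD.
pose E : set R := [set `|\det A| | A in
  [set A : 'M[R]_n | forall i, Om (p0 + row i A)]].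
have [r r0 rOm] := open_cube oOm Op0.
have Er : E (r ^+ n).
  exists r%:M; last by rewrite det_scalar ger0_norm// exprn_ge0// ltW.
  move=> i; apply: rOm; rewrite /cube /= addrC addKr.
  apply/norm_coord_le => [|j]; first exact: ltW.
  rewrite !mxE; case: (i == j); first by rewrite mulr1n gtr0_norm.
  by rewrite mulr0n normr0 ltW.
have supE : has_sup E.
  split; first by exists (r ^+ n).
  exists (\sum_(s : 'S_n) D ^+ n) => _ [A AOm <-].
  by apply: det_le => i; have := OmD _ (AOm i); rewrite addrC addKr.
have s0 : 0 < sup E.
  by apply: lt_le_trans (ub_le_sup supE.2 Er); rewrite exprn_gt0.
(* [Om] is open, so the supremum may fail to be attained; half of it is enough, and this factor is
   the bound 2 on [dot w (x - p0)]. *)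
have [|_ [A AOm <-] Amax] := sup_adherent _ supE (eps := sup E / 2); first lra.
have {}Amax : sup E < 2 * `|\det A| by lra.
have detA : \det A != 0 by rewrite -normr_gt0; lra.
have uA : A \in unitmx by rewrite unitmxE unitfE.
(* The basis dual to the rows of [A]. *)
pose w i : 'rV[R]_n := (col i (invmx A))^T.
have dotw i y : dot (w i) y = (y *m invmx A) ord0 i.
  by rewrite [RHS]mxE; apply: eq_bigr => j _; rewrite !mxE mulrC.
have wOm i x : Om x -> `|dot (w i) (x - p0)| <= 2.
  move=> Ox; rewrite dotw /invmx uA -scalemxAr mxE -det_row_subst normrM normfV.
  rewrite mulrC ler_pdivrMr ?normr_gt0//.
  apply: le_trans (ltW Amax); apply: (ub_le_sup supE.2).
  exists (row_subst A i (x - p0)) => // k; rewrite row_row_subst; case: ifP => _.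
    by rewrite addrC subrK.
  exact: AOm.
have dotwA i k : dot (w i) (row k A) = (k == i)%:R.
  by rewrite dotw -row_mul mulmxV// !mxE.
have w0 i : w i != 0.
  apply/negP => /eqP wi0; have := dotwA i i; rewrite wi0 eqxx /dot.
  under eq_bigr do rewrite mxE mul0r.
  by rewrite big1// => /eqP; rewrite eq_sym oner_eq0.
pose i0 := Ordinal n0.
(* The longest dual vector corresponds to the smallest height of the simplex; one cube radius then
   suits all coordinates. *)
pose j := [arg max_(i > i0) enorm (w i)]%O.
have jmax i : enorm (w i) <= enorm (w j).
  by rewrite /j; case: arg_maxP => // k _; apply.
have wj0 := enorm_gt0 (w0 j).
have n0' : 0 < n%:R :> R by rewrite ltr0n.
(* All simplex coordinates of [q] are [1 / (2 n)]. Varying each by at most [1 / (2 n)] keeps it in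
   [[0, 1 / n]], hence the sum below 1. *)
pose q := p0 + (2 * n%:R)^-1 *: \sum_k row k A.
exists (w j), q; split => //; first exact: wOm.
move=> z; rewrite /cube /= => zq.
pose t := (z - p0) *m invmx A.
have tE i : t ord0 i = dot (w i) (z - q) + (2 * n%:R)^-1.
  rewrite /t -dotw.
  have -> : z - p0 = z - q + (2 * n%:R)^-1 *: \sum_k row k A.
    by apply/rowP => l; rewrite !mxE; ring.
  rewrite dotDr dotZr; congr (_ + _).
  have -> : dot (w i) (\sum_k row k A) = \sum_k dot (w i) (row k A).
    rewrite (big_morph (dot (w i)) (id1 := 0) (op1 := +%R)) => //.
      by move=> u v; rewrite dotDr.
    by rewrite -(scale0r 0) dotZr mul0r.
  under eq_bigr do rewrite dotwA.
  rewrite (bigD1 i)//= eqxx big1 ?addr0 ?mulr1// => k /negPf ->.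
  by [].
have tb i : 0 <= t ord0 i <= n%:R^-1.
  have : `|dot (w i) (z - q)| <= (2 * n%:R)^-1.
    apply: le_trans (dot_le_norm _ _) _.
    apply: (@le_trans _ _ (n%:R * enorm (w j) * (2 * n%:R ^+ 2 * enorm (w j))^-1)).
      by rewrite ler_pM// ?mulr_ge0 ?enorm_ge0 ?ler_pM2l.
    rewrite le_eqVlt; apply/orP; left; apply/eqP; field.
    by rewrite !gt_eqF.
  rewrite ler_norml tE => /andP[h1 h2].
  have -> : n%:R^-1 = (2 * n%:R)^-1 + (2 * n%:R)^-1 :> R by field; rewrite gt_eqF.
  by rewrite lerD2r h2 andbT; lra.
have -> : z = p0 + \sum_(q <- [seq (t ord0 i, row i A) | i <- enum 'I_n]) q.1 *: q.2.
  rewrite big_map big_enum /= -mulmx_sum_row mulmxKV//.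
  by rewrite addrC subrK.
apply: convex_comb => //.
  move=> _ /mapP[i _ ->] /=; split => //.
  by have /andP[] := tb i.
rewrite big_map big_enum /=.
apply: (@le_trans _ _ (\sum_(i < n) n%:R^-1)).
  by apply: ler_sum => i _; have /andP[] := tb i.
by rewrite sumr_const card_ord -(mulr_natl n%:R^-1) mulfV// gt_eqF.
Qed.

End slab.

Section separation.
Variables (R : realType) (n : nat).
Local Notation V := 'rV[R]_n.
Implicit Types (Om : set V) (x y z v : V).

Lemma continuous_sum (T : topologicalType) (I : Type) (s : seq I) (f : I -> T -> R) :
  (forall i, continuous (f i)) -> continuous (fun t => \sum_(i <- s) f i t).
Proof.
move=> fc x; elim: s => [|i s IHs].
  under eq_fun do rewrite big_nil.
  exact: cvg_cst.
under eq_fun do rewrite big_cons.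
by apply: cvgD => //; exact: fc.
Qed.

Lemma continuous_coord i : continuous (fun x => x ord0 i).
Proof. exact: coord_continuous. Qed.

Lemma continuous_dot z : continuous (fun x => dot z x).
Proof.
apply: continuous_sum => i x.
exact: cvgM (cvg_cst _) (@continuous_coord i x).
Qed.

Lemma dot_sqrD x y : dot (x + y) (x + y) = dot x x + 2 * dot x y + dot y y.
Proof. rewrite dotDl !dotDr (dotC y x); ring. Qed.

Lemma continuous_sqdist z : continuous (fun x => dot (x - z) (x - z)).
Proof.
have -> : (fun x => dot (x - z) (x - z)) =
    (fun x => \sum_i (x ord0 i - z ord0 i) * (x ord0 i - z ord0 i)).
  by apply/funext => x; apply: eq_bigr => i _; rewrite !mxE.
apply: continuous_sum => i x.
have c : (fun x => x ord0 i - z ord0 i) y @[y --> x] --> x ord0 i - z ord0 i.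
  exact: cvgB (@continuous_coord i x) (cvg_cst _).
exact: (cvgM c c).
Qed.

Lemma compact_closure Om (D : R) : (forall x, Om x -> `|x| <= D) ->
  compact (closure Om).
Proof.
move=> OmD; apply: bounded_closed_compact; last exact: closed_closure.
exists (D + 1); split; first exact: num_real.
move=> M DM x /closure_normP/(_ 1 ltr01)[y /OmD yD xy].
by rewrite /= -[x](subrK y) (le_trans (ler_normD _ _))//; lra.
Qed.

Lemma closure_self Om x : Om x -> closure Om x.
Proof. exact: subset_closure. Qed.

(** The normal is the direction from [z] to the nearest point of the closure, which requires [z]
    outside the closure. Boundary points are therefore reached as limits of such [z]. *)
Lemma separation Om x0 (r D : R) z : convex Om -> 0 < r -> cube x0 r `<=` Om ->
  (forall x, Om x -> `|x| <= D) -> ~ closure Om z ->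
  exists2 v, enorm v = 1 & forall x, Om x -> 0 <= dot v (x - z).
Proof.
move=> cOm r0 rOm OmD zOm.
(* [c] is the point of the closure of [Om] nearest to [z]. *)
have [|||c Oc cmin] := @EVT_min_rV R n (fun x => dot (x - z) (x - z)) (closure Om).
- by exists x0; apply: closure_self; apply: cube_center rOm; exact: ltW.
- exact: compact_closure OmD.
- by apply: continuous_subspaceT; exact: continuous_sqdist.
rewrite inE in Oc.
pose v := c - z.
have v0 : v != 0 by apply/negP => /eqP/subr0_eq cz; apply: zOm; rewrite -cz.
have nv := enorm_gt0 v0.
exists ((enorm v)^-1 *: v).
  rewrite enormE dotZl dotZr -sqr_enorm.
  have -> : (enorm v)^-1 * ((enorm v)^-1 * enorm v ^+ 2) = 1.
    by field; rewrite gt_eqF.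
  by rewrite sqrtr1.
move=> x Ox; rewrite dotZl; apply: mulr_ge0; first by rewrite invr_ge0 ltW.
suff H : 0 <= dot v (x - c).
  have -> : x - z = (x - c) + v by rewrite /v addrA subrK.
  by rewrite dotDr addr_ge0// dot_ge0.
rewrite leNgt; apply/negP => vxc.
have xOm (t : R) : 0 < t <= 1 -> closure Om (t *: x + (1 - t) *: c).
  move=> /andP[t0 t1].
  apply/closure_normP => e e0.
  have /closure_normP/(_ _ e0)[c' Oc' cc'] := Oc.
  exists (t *: x + (1 - t) *: c'); first by apply: cOm => //; rewrite t1 ltW.
  have -> : t *: x + (1 - t) *: c - (t *: x + (1 - t) *: c') = (1 - t) *: (c - c').
    by apply/rowP => i; rewrite !mxE; ring.
  apply: le_lt_trans cc'; rewrite normrZ ger0_norm ?subr_ge0//.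
  by rewrite ler_piMl//; lra.
pose a := - dot v (x - c); have a0 : 0 < a by rewrite oppr_gt0.
pose b := dot (x - c) (x - c); have b0 : 0 <= b by exact: dot_ge0.
have ab : 0 < a + b by rewrite ltr_wpDr.
(* Any [t] with [t * b < a] makes the increment [t ^+ 2 * b - 2 * t * a] of the squared distance
   negative. *)
pose t := a / (a + b).
have t01 : 0 < t <= 1.
  by rewrite divr_gt0//= ler_pdivrMr// mul1r lerDl.
have := cmin _ (mem_set (xOm _ t01)).
have -> : t *: x + (1 - t) *: c - z = v + t *: (x - c).
  by apply/rowP => i; rewrite !mxE; ring.
rewrite (dot_sqrD v) -/v dotZl !dotZr -/b.
have -> : dot v (x - c) = - a by rewrite opprK.
have h1 : t * b < a.
  have [->|b0'] := eqVneq b 0; first by rewrite mulr0.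
  rewrite /t mulrAC ltr_pdivrMr// ltr_pM2l// ltrDr//.
have /andP[t0 _] := t01.
have := ltr_pM2l t0 (t * b) a; rewrite h1 => h2.
by rewrite leNgt => /negP; apply; nra.
Qed.

(** The point is taken at the supremum of the parameters that stay in [Om]: it is a limit of points
    of [Om], and by openness it cannot belong to [Om]. *)
Lemma ray_boundary Om x v (T : R) : open Om -> Om x -> 0 <= T ->
  ~ Om (x + T *: v) -> exists2 t, 0 <= t <= T & boundary Om (x + t *: v).
Proof.
move=> oOm Ox T0 OT.
pose E : set R := [set t | 0 <= t <= T /\ Om (x + t *: v)].
have E0 : E 0 by split; rewrite ?lexx// scale0r addr0.
have supE : has_sup E by split; [exists 0|exists T => t [/andP[]]].
have s0 : 0 <= sup E by exact: (ub_le_sup supE.2 E0).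
have sT : sup E <= T by apply: ge_sup; [exists 0|move=> t [/andP[]]].
exists (sup E); first by rewrite s0.
have nv : 0 < `|v| + 1 by rewrite ltr_wpDl.
apply/(boundaryP _ oOm); split.
  apply/closure_normP => e e0.
  have [|t Et st] := sup_adherent (eps := e / (`|v| + 1)) _ supE.
    by rewrite divr_gt0.
  exists (x + t *: v); first exact: Et.2.
  rewrite opprD addrACA subrr add0r -scalerBl normrZ ger0_norm; last first.
    by rewrite subr_ge0; exact: (ub_le_sup supE.2 Et).
  have st' : sup E - t < e / (`|v| + 1) by lra.
  have : 0 <= sup E - t by rewrite subr_ge0; exact: (ub_le_sup supE.2 Et).
  rewrite ltr_pdivlMr// in st'; nra.
move=> Os; have {}sT : sup E < T.
  by rewrite lt_def sT andbT; apply/eqP => sT'; apply: OT; rewrite sT'.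
have [r r0 rOm] := open_cube oOm Os.
pose d := Num.min (T - sup E) (r / (`|v| + 1)).
have d0 : 0 < d by rewrite lt_min subr_gt0 sT divr_gt0.
have : E (sup E + d).
  split.
    by rewrite addr_ge0 ?(ltW d0)//= -lerBrDl ge_min lexx.
  apply: rOm; rewrite /cube /= opprD addrACA subrr add0r -scalerBl addrAC subrr.
  rewrite add0r normrZ gtr0_norm//.
  have : d <= r / (`|v| + 1) by rewrite ge_min lexx orbT.
  rewrite ler_pdivlMr// => h; nra.
by move=> /(ub_le_sup supE.2); lra.
Qed.

(** Otherwise [y] would lie strictly inside the cone over the cube at [x0] with apex the pushed
    point. This supplies the exterior points needed by [separation]. *)
Lemma boundary_outside Om x0 (r : R) y (t : R) : convex Om -> open Om -> 0 < r ->
  cube x0 r `<=` Om -> boundary Om y -> 0 < t -> ~ closure Om (y + t *: (y - x0)).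
Proof.
move=> cOm oOm r0 rOm /(boundaryP _ oOm)[_ Oy] t0 cl; apply: Oy.
have t1 : 0 < 1 + t by lra.
apply: (convex_closure_cube cOm r0 rOm cl (s := t / (1 + t))).
  by rewrite divr_gt0//= ler_pdivrMr//; lra.
have -> : y - ((1 - t / (1 + t)) *: (y + t *: (y - x0)) + t / (1 + t) *: x0) = 0.
  by apply/rowP => i; rewrite !mxE; field; rewrite gt_eqF.
by rewrite normr0 mulr_gt0// divr_gt0.
Qed.

(** Changing the ratio of a homothety of centre [x0] by [t] yields room [t * r]; the choice
    [t = 2 * e / r] makes this twice the distance [e]. *)
Lemma boundary_shell Om x0 (r e : R) y z : convex Om -> open Om -> 0 < r ->
  cube x0 r `<=` Om -> boundary Om y -> 0 < e -> 2 * e < r -> `|z - y| <= e ->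
  (exists2 x, Om x & z = x0 + (1 + 2 * e / r) *: (x - x0)) /\
  ~ (exists2 x, Om x & z = x0 + (1 - 2 * e / r) *: (x - x0)).
Proof.
move=> cOm oOm r0 rOm /(boundaryP _ oOm)[cy Oy] e0 er zy.
set t := 2 * e / r.
have t0 : 0 < t by rewrite divr_gt0//; lra.
have t1 : t < 1 by rewrite ltr_pdivrMr//; lra.
have tr : t * r = 2 * e by rewrite divfK// gt_eqF.
split.
  exists (x0 + (1 + t)^-1 *: (z - x0)); last first.
    by apply/rowP => i; rewrite !mxE; field; rewrite gt_eqF//; lra.
  apply: (convex_closure_cube cOm r0 rOm cy (s := t / (1 + t))).
    by rewrite divr_gt0 ?ler_pdivrMr//=; lra.
  have -> : x0 + (1 + t)^-1 *: (z - x0) -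
      ((1 - t / (1 + t)) *: y + t / (1 + t) *: x0) = (1 + t)^-1 *: (z - y).
    by apply/rowP => i; rewrite !mxE; field; rewrite gt_eqF//; lra.
  rewrite normrZ gtr0_norm ?invr_gt0; last lra.
  rewrite mulrAC mulrC ltr_pM2r ?invr_gt0; lra.
move=> [x Ox zE]; apply: Oy.
apply: (convex_cube cOm r0 rOm Ox (s := t)); first by rewrite t0 ltW.
have -> : (1 - t) *: x + t *: x0 = z by rewrite zE; apply/rowP => i; rewrite !mxE; ring.
by rewrite distrC tr; lra.
Qed.

End separation.

(** * Surface area *)

Section finite_covers.
Variables (R : realType) (T I : Type) (S : I -> set T) (w : I -> \bar R).
Hypothesis w_ge0 : forall i, (0 <= w i)%E.

Lemma cover_measure_finite A N (i : nat -> I) (W : \bar R) :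
  A `<=` [set x | exists2 k, (k < N)%N & S (i k) x] ->
  (forall k, (w (i k) <= W)%E) ->
  (cover_measure S w A <= N%:R%:E * W)%E.
Proof.
move=> AS wW; pose c k := if (k < N)%N then Some (i k) else None.
have c0 k : (0 <= oapp w 0 (c k))%E by rewrite /c; case: ifP => //= _; exact: w_ge0.
apply: (@le_trans _ _ (\sum_(k <oo) oapp w 0 (c k))%E).
  apply: ereal_inf_lbound; exists c => // x /AS[k kN Sx].
  by exists k => //; rewrite /c kN.
rewrite (nneseries_split 0 N) => [|k _]; last exact: c0.
rewrite add0n [X in (_ + X)%E]eseries0 => [|k Nk _]; last first.
  by rewrite /c ltnNge Nk.
rewrite adde0; apply: (@le_trans _ _ (\sum_(0 <= k < N) W)%E).
  rewrite !big_seq; apply: lee_sum => k; rewrite mem_index_iota => /andP[_ kN].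
  by rewrite /c kN; exact: wW.
by rewrite sumr_const_nat subn0 mule_natl.
Qed.

End finite_covers.

Section hausdorff.
Variable R : realType.

(** The unit ball lies between cubes of radii [1 / m] and 1. The value of the constant never
    matters. *)
Lemma hausdorff_constE m : (0 < m)%N ->
  exists2 k : R, 0 < k & hausdorff_const R m = k%:E.
Proof.
move=> m0; have m0' : 0 < m%:R :> R by rewrite ltr0n.
set B := [set x : 'rV[R]_m | enorm x <= 1].
have vB : (lebesgue_outer B <= (2 ^+ m)%:E)%E.
  rewrite -[2]mulr1 -(lebesgue_outer_cube (0 : 'rV[R]_m)) ?ler01//.
  apply: le_lebesgue_outer => x /= Bx; rewrite /cube /= subr0.
  exact: le_trans (norm_le_enorm _) Bx.
have vB' : (((2 * m%:R^-1) ^+ m)%:E <= lebesgue_outer B)%E.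
  rewrite -(lebesgue_outer_cube (0 : 'rV[R]_m)) ?invr_ge0 ?ler0n//.
  apply: le_lebesgue_outer => x; rewrite /cube /= subr0 => xm.
  apply: le_trans (enorm_le_norm _) _.
  by rewrite mulrC -ler_pdivlMr// mul1r.
have fB : lebesgue_outer B \is a fin_num.
  rewrite ge0_fin_numE; first by apply: le_lt_trans vB _; rewrite ltry.
  by apply: le_trans vB'; rewrite lee_fin exprn_ge0// mulr_ge0// invr_ge0 ltW.
exists (fine (lebesgue_outer B) * (2 ^+ m)^-1); last first.
  by rewrite EFinM fineK.
rewrite mulr_gt0 ?invr_gt0 ?exprn_gt0//.
rewrite -lte_fin fineK//; apply: lt_le_trans vB'.
by rewrite lte_fin exprn_gt0// mulr_gt0// invr_gt0.
Qed.

Variable n : nat.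
Local Notation V := 'rV[R]_n.
Implicit Types (A B Om : set V) (x y z v : V).

Lemma lebesgue_outer0 : lebesgue_outer (set0 : set V) = 0%E.
Proof. exact: cover_measure0 (@box_volume_ge0 R n). Qed.

Lemma diameterE B (e : R) : (diameter B <= e%:E)%E ->
  exists D : R, [/\ diameter B = D%:E, 0 <= D, D <= e &
    forall x y, B x -> B y -> enorm (x - y) <= D].
Proof.
move=> Be; have d0 : (0 <= diameter B)%E by rewrite /diameter le_max lexx.
have dfin : diameter B \is a fin_num.
  by rewrite ge0_fin_numE// (le_lt_trans Be)// ltry.
exists (fine (diameter B)); split; rewrite ?fineK//.
- by rewrite -lee_fin fineK.
- by rewrite -lee_fin fineK.
- move=> x y Bx By; rewrite -lee_fin fineK// /diameter le_max; apply/orP; right.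
  by apply: ereal_sup_ubound; exists x => //; exists y.
Qed.

Lemma diameter_cube x (e : R) : 0 <= e ->
  (diameter (cube x e) <= (n%:R * (2 * e))%:E)%E.
Proof.
move=> e0; rewrite /diameter ge_max lee_fin !mulr_ge0//=.
apply: ge_ereal_sup => _ [y xy [z xz <-]]; rewrite lee_fin.
apply: le_trans (enorm_le_norm _) _; rewrite ler_wpM2l//.
have -> : y - z = (y - x) - (z - x) by rewrite opprB addrA subrK.
apply: le_trans (ler_normB _ _) _; rewrite /cube /= in xy xz; lra.
Qed.

Lemma diameter_ge0 B : (0 <= diameter B)%E.
Proof. by rewrite /diameter le_max lexx. Qed.

(** Cubes of radius [e / 2] at the given points are disjoint and lie in the shell between the
    homothetic copies of [Om] of ratios [1 - e / r] and [1 + e / r], whose volume is of order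
    [e / r]. *)
Lemma separated_boundary Om x0 (r e : R) (s : seq V) : (0 < n)%N -> convex Om ->
  open Om -> lebesgue_outer Om = 1%E -> 0 < r -> cube x0 r `<=` Om ->
  0 < e -> e < r -> (forall c, c \in s -> boundary Om c) ->
  pairwise (fun c c' : V => e < `|c - c'|) s ->
  (size s)%:R * e ^+ n.-1 <= n%:R * 2 ^+ n / r.
Proof.
move=> n0 cOm oOm vOm r0 rOm e0 er sbd ps.
pose t := e / r.
have t0 : 0 < t by rewrite divr_gt0.
have t1 : t < 1 by rewrite ltr_pdivrMr// mul1r.
pose S : set V := [set (- t *: x0 + (1 + t) *: x)%R | x in Om].
pose T : set V := [set (t *: x0 + (1 - t) *: x)%R | x in Om].
have tE : 2 * (e / 2) / r = t by rewrite /t; field; rewrite gt_eqF.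
have shell c z : c \in s -> cube c (e / 2) z -> S z /\ ~ T z.
  move=> /sbd bc cz.
  have [||[x Ox zE] nT] := boundary_shell (z := z) cOm oOm r0 rOm bc (e := e / 2) _ _ cz.
  - lra.
  - lra.
  rewrite !tE in zE nT; split.
    by exists x => //; rewrite zE; apply/rowP => i; rewrite !mxE; ring.
  move=> [y Oy yz]; apply: nT; exists y => //.
  by rewrite -yz; apply/rowP => i; rewrite !mxE; ring.
have Ox0 : Om x0 by apply: cube_center rOm; exact: ltW.
have TOm : T `<=` Om.
  move=> _ [x Ox <-]; rewrite -[in X in X *: x0](subKr 1 t).
  rewrite addrC; apply: cOm => //; apply/andP; split; lra.
have TS : T `<=` S.
  move=> z /TOm Oz; exists ((1 - t / (1 + t)) *: z + t / (1 + t) *: x0).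
    have -> : t / (1 + t) *: x0 = (1 - (1 - t / (1 + t))) *: x0 by rewrite subKr.
    have h : 0 <= t / (1 + t) <= 1.
      by apply/andP; split; rewrite ?divr_ge0 ?addr_ge0 ?ltW// ltr_pdivrMr ?addr_gt0//; lra.
    by apply: cOm => //; apply/andP; split; lra.
  by apply/rowP => i; rewrite !mxE; field; rewrite gt_eqF//; lra.
have := @packing R n S T s (e / 2); rewrite [2 * _]mulrC divfK//.
move=> /(_ _ TS _ _ ps) H.
have {H} H : (((size s)%:R * e ^+ n)%:E + lebesgue_outer T <= lebesgue_outer S)%E.
  apply: H; first lra.
  - by move=> c cs z /(shell _ _ cs)[].
  - by move=> c cs; rewrite -subset0 => z [/(shell _ _ cs)[_ nT] /nT].
have vS : (lebesgue_outer S <= ((1 + t) ^+ n)%:E)%E.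
  apply: le_trans (lebesgue_outer_affine _ _ _) _; first lra.
  by rewrite vOm mule1.
have vT : (((1 - t) ^+ n)%:E <= lebesgue_outer T)%E.
  have u0 : 0 < 1 - t by lra.
  have : (lebesgue_outer Om <= (((1 - t)^-1) ^+ n)%:E * lebesgue_outer T)%E.
    apply: le_trans (lebesgue_outer_affine (- (t / (1 - t)) *: x0) _ _).
      apply: le_lebesgue_outer => x Ox; exists (t *: x0 + (1 - t) *: x).
        by exists x.
      by apply/rowP => i; rewrite !mxE; field; rewrite gt_eqF.
    by rewrite invr_gt0.
  rewrite vOm exprVn => h.
  by move: h; rewrite lee_pdivlMl ?exprn_gt0// mule1.
have {vS vT} H2 : (size s)%:R * e ^+ n + (1 - t) ^+ n <= (1 + t) ^+ n.
  rewrite -lee_fin EFinD; apply: le_trans vS; apply: le_trans H.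
  by rewrite leeD2l.
have H3 : (1 + t) ^+ n - (1 - t) ^+ n <= n%:R * 2 ^+ n * t.
  rewrite subrXX.
  have -> : (1 + t - (1 - t)) = 2 * t by ring.
  apply: (@le_trans _ _ (2 * t * \sum_(i < n) 2 ^+ n.-1)).
    apply: ler_wpM2l; first by rewrite mulr_ge0// ltW.
    apply: ler_sum => i _.
    rewrite -[leRHS]mulr1; apply: ler_pM; rewrite ?exprn_ge0 ?exprn_ile1//; try lra.
    apply: (@le_trans _ _ (2 ^+ (n.-1 - i))); first by apply: lerXn2r; rewrite ?nnegrE; lra.
    by apply: ler_weXn2l; [lra|exact: leq_subr].
  rewrite sumr_const card_ord -(prednK n0) exprS -mulr_natl /=.
  by rewrite le_eqVlt; apply/orP; left; apply/eqP; ring.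
rewrite -(ler_pM2r e0).
have -> : (size s)%:R * e ^+ n.-1 * e = (size s)%:R * e ^+ n.
  by rewrite -mulrA -exprSr prednK.
apply: (@le_trans _ _ (n%:R * 2 ^+ n * t)); first lra.
by rewrite /t mulrA mulrAC.
Qed.

(** A separated family of largest cardinality is a net, since any point far from it could be
    added. *)
Lemma maximal_separated A (e : R) (B : nat) :
  (forall s : seq V, (forall c, c \in s -> A c) ->
    pairwise (fun c c' : V => e < `|c - c'|) s -> (size s <= B)%N) ->
  exists s : seq V, [/\ forall c, c \in s -> A c,
    pairwise (fun c c' : V => e < `|c - c'|) s &
    forall y, A y -> exists2 c, c \in s & `|y - c| <= e].
Proof.
move=> HB.
pose P N := `[< exists s : seq V, [/\ size s = N, forall c, c \in s -> A c &
    pairwise (fun c c' : V => e < `|c - c'|) s] >].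
have P0 : exists N, P N by exists 0%N; apply/asboolP; exists [::].
have PB N : P N -> (N <= B)%N by move=> /asboolP[s [<- sA ps]]; exact: HB.
have [N /asboolP[s [sN sA ps]] Nmax] := ex_maxnP P0 PB.
exists s; split => // y Ay; apply: contrapT => ny.
suff /Nmax : P N.+1 by rewrite ltnn.
apply/asboolP; exists (y :: s); split; first by rewrite /= sN.
- by move=> c; rewrite inE => /orP[/eqP->//|]; exact: sA.
- rewrite pairwise_cons ps andbT; apply/allP => c cs; rewrite ltNge.
  by apply/negP => yc; apply: ny; exists c.
Qed.

(** At every scale [e] the boundary is covered by [O(e ^ (1 - n) / r)] cubes of radius [e], each of
    weight [O(e ^ (n - 1))]. *)
Lemma surface_area_le : (1 < n)%N -> exists2 C : R, 0 < C &
  forall Om x0 (r : R), convex Om -> open Om -> lebesgue_outer Om = 1%E -> 0 < r ->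
    cube x0 r `<=` Om -> (surface_area Om <= (C / r)%:E)%E.
Proof.
move=> n1; have n0 : (0 < n)%N by exact: ltnW.
have n0' : 0 < n%:R :> R by rewrite ltr0n.
have m0 : (0 < n.-1)%N by rewrite -subn1 subn_gt0.
have [k k0 kE] := hausdorff_constE m0.
exists (k * (2 * n%:R) ^+ n.-1 * (n%:R * 2 ^+ n)).
  by rewrite !mulr_gt0 ?exprn_gt0 ?mulr_gt0.
move=> Om x0 r cOm oOm vOm r0 rOm.
apply: ge_ereal_sup => _ [delta /= d0 <-].
pose e := Num.min (delta / (2 * n%:R)) (r / 2).
have e0 : 0 < e by rewrite lt_min !divr_gt0// mulr_gt0.
have er : e < r.
  by apply: (@le_lt_trans _ _ (r / 2)); [rewrite ge_min lexx orbT|lra].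
have ed : n%:R * (2 * e) <= delta.
  have : e <= delta / (2 * n%:R) by rewrite ge_min lexx.
  by rewrite ler_pdivlMr ?mulr_gt0//; lra.
have sepN s (sA : forall c, c \in s -> boundary Om c) ps :=
  separated_boundary n0 cOm oOm vOm r0 rOm e0 er sA ps.
have [|s [sA ps smax]] := @maximal_separated (boundary Om) e
    (Num.truncn (n%:R * 2 ^+ n / r / e ^+ n.-1)).
  move=> s sA ps; rewrite truncn_ge_nat.
    by rewrite ler_pdivlMr ?exprn_gt0//; exact: sepN.
  by rewrite !divr_ge0 ?mulr_ge0 ?exprn_ge0 ?ltW.
have dc j : (diameter (cube (nth (0%R : V) s j) e) <= delta%:E)%E.
  by apply: le_trans (diameter_cube _ (ltW e0)) _; rewrite lee_fin.
pose c j : {B : set V | (diameter B <= delta%:E)%E} :=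
  exist (fun B : set V => (diameter B <= delta%:E)%E) _ (dc j).
apply: le_trans (@cover_measure_finite _ _ _ _ _ _ _ (size s) c
    (k * (n%:R * (2 * e)) ^+ n.-1)%:E _ _) _.
- by move=> [B dB]; rewrite kE mule_ge0 ?lee_fin ?(ltW k0)// expe_ge0 ?diameter_ge0.
- move=> y /smax[z zs yz]; exists (index z s); first by rewrite index_mem.
  by rewrite /c /= nth_index.
- move=> j /=; rewrite kE.
  have [D [-> D0 De _]] := diameterE (diameter_cube (nth (0%R : V) s j) (ltW e0)).
  rewrite -EFin_expe -EFinM lee_fin ler_pM2l//.
  by apply: lerXn2r; rewrite ?nnegrE// mulr_ge0// mulr_ge0// ltW.
rewrite -EFinM lee_fin.
have -> : n%:R * (2 * e) = (2 * n%:R) * e by ring.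
rewrite exprMn.
have -> : (size s)%:R * (k * ((2 * n%:R) ^+ n.-1 * e ^+ n.-1)) =
  (k * (2 * n%:R) ^+ n.-1) * ((size s)%:R * e ^+ n.-1) by ring.
rewrite -[leRHS]mulrA ler_pM2l; first exact: sepN.
by rewrite mulr_gt0 ?exprn_gt0 ?mulr_gt0.
Qed.

(** The Minkowski sum of [B] and the segment from [- v] to 0. *)
Definition tube v B : set V :=
  [set x | exists2 t : R, 0 <= t <= 1 & B (x + t *: v)].

Lemma tube_volume_gt0 v B (D : R) : (0 < n)%N -> 0 < D <= `|v| ->
  (forall x y, B x -> B y -> `|x - y| <= D) ->
  (lebesgue_outer (tube v B) <= (3 * 4 ^+ n * `|v| * D ^+ n.-1)%:E)%E.
Proof.
move=> n0 /andP[D0 Dv] BD; set L := `|v|.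
have [[b Bb]|B0] := pselect (exists b, B b); last first.
  have -> : tube v B = set0.
    by rewrite -subset0 => x [t _ Bt]; apply: B0; exists (x + t *: v).
  rewrite lebesgue_outer0 lee_fin.
  rewrite mulr_ge0//; last by rewrite exprn_ge0 ?ltW.
  by rewrite mulr_ge0 ?normr_ge0// mulr_ge0// exprn_ge0.
have L0 : 0 < L by exact: lt_le_trans Dv.
pose N := Num.truncn (L / D).
have /andP[N1 N2] : N%:R <= L / D < N.+1%:R by apply: truncn_itv; rewrite divr_ge0 ?ltW.
rewrite ler_pdivlMr// in N1; rewrite ltr_pdivrMr// in N2.
have M0 : 0 < N.+1%:R :> R by rewrite ltr0n.
pose p j := b - (j%:R / N.+1%:R) *: v.
have cE j : cube (p j) (2 * D) =
    box (p j - const_mx (2 * D), p j + const_mx (2 * D)).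
  by apply: cubeE; lra.
(* The centres [p j] are less than [D] apart, and the radius [2 * D] accounts for this step and for
   the size of [B]. The index reaches [N.+1] when [t = 1], hence [N.+2] cubes, and
   [N.+2%:R * D <= 3 * L]. *)
apply: le_trans (@cover_measure_finite _ _ _ _ _ (@box_volume_ge0 R n) _ N.+2
   (fun j => (p j - const_mx (2 * D), p j + const_mx (2 * D)))
   ((2 * (2 * D)) ^+ n)%:E _ _) _.
- move=> x [t /andP[t0 t1] Bt]; pose j := Num.truncn (t * N.+1%:R).
  have /andP[j1 j2] : j%:R <= t * N.+1%:R < j.+1%:R.
    by apply: truncn_itv; rewrite mulr_ge0.
  exists j.
    rewrite ltnS -(ler_nat R); apply: le_trans j1 _.
    by rewrite -[leRHS]mul1r ler_pM2r.
  rewrite -cE /cube /=.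
  have -> : x - p j = (x + t *: v - b) - (t - j%:R / N.+1%:R) *: v.
    by apply/rowP => i; rewrite !mxE; ring.
  apply: le_trans (ler_normB _ _) _.
  have h1 := BD _ _ Bt Bb.
  suff h2 : `|(t - j%:R / N.+1%:R) *: v| <= D by lra.
  rewrite normrZ -/L ger0_norm; last by rewrite subr_ge0 ler_pdivrMr.
  have h3 : t - j%:R / N.+1%:R <= N.+1%:R^-1.
    rewrite lerBlDr -{1}[N.+1%:R^-1]mul1r -mulrDl ler_pdivlMr//.
    by rewrite addrC natr1 ltW.
  apply: le_trans (ler_wpM2r (ltW L0) h3) _.
  by rewrite mulrC ler_pdivrMr// mulrC ltW.
- by move=> j; rewrite -lebesgue_outer_box -cE lebesgue_outer_cube//; lra.
rewrite -EFinM lee_fin.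
have -> : (2 * (2 * D)) ^+ n = 4 ^+ n * D ^+ n.-1 * D.
  by rewrite -mulrA -exprSr prednK// -exprMn; congr (_ ^+ _); ring.
have h : N.+2%:R * D <= 3 * L.
  have DL : D <= L by [].
  rewrite -natr1 -natr1 !mulrDl mul1r; lra.
have -> : N.+2%:R * (4 ^+ n * D ^+ n.-1 * D) = (N.+2%:R * D) * (4 ^+ n * D ^+ n.-1) by ring.
have -> : 3 * 4 ^+ n * L * D ^+ n.-1 = (3 * L) * (4 ^+ n * D ^+ n.-1) by ring.
by rewrite ler_wpM2r// mulr_ge0 ?exprn_ge0// ltW.
Qed.

(** Adds the case [D = 0] by letting a positive bound on the diameter tend to 0; here [n > 1] makes
    [D ^+ n.-1] vanish. *)
Lemma tube_volume v B (D : R) : (1 < n)%N -> 0 < `|v| -> 0 <= D <= `|v| ->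
  (forall x y, B x -> B y -> `|x - y| <= D) ->
  (lebesgue_outer (tube v B) <= (3 * 4 ^+ n * `|v| * D ^+ n.-1)%:E)%E.
Proof.
move=> n1 v0 /andP[D0 Dv] BD; have n0 := ltnW n1.
have m0 : (0 < n.-1)%N by rewrite -subn1 subn_gt0.
have [DE|Dneq] := eqVneq D 0; last first.
  by apply: tube_volume_gt0 => //; rewrite Dv andbT lt_def Dneq.
rewrite DE expr0n -[n.-1 == _]negbK -lt0n m0 mulr0.
set K := 3 * 4 ^+ n * `|v|.
have K0 : 0 < K by rewrite !mulr_gt0// exprn_gt0.
apply/lee_addgt0Pr => e e0; rewrite add0e.
pose D' := Num.min `|v| (Num.min 1 (e / K)).
have D'0 : 0 < D' by rewrite !lt_min v0 ltr01 divr_gt0.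
apply: le_trans (@tube_volume_gt0 v B D' n0 _ _) _.
- by rewrite D'0 ge_min lexx.
- by move=> x y Bx By; apply: le_trans (BD _ _ Bx By) _; rewrite DE ltW.
rewrite lee_fin -/K.
have D'1 : D' <= 1 by rewrite !ge_min lexx !orbT.
have D'e : D' <= e / K by rewrite !ge_min lexx !orbT.
apply: (@le_trans _ _ (K * D')).
  by rewrite ler_pM2l// -{2}[D']expr1; apply: ler_wiXn2l => //; exact: ltW.
by rewrite mulrC -ler_pdivlMr.
Qed.

(* The segments [x, x + v] which leave the domain hit its boundary, so that the
   translates of the sets covering the boundary sweep the domain. *)
Lemma surface_area_ge : (1 < n)%N -> exists2 C : R, 0 < C &
  forall Om v, lebesgue_outer Om = 1%E -> 0 < `|v| ->
    (forall x, Om x -> exists2 t, 0 <= t <= 1 & boundary Om (x + t *: v)) ->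
    ((C / `|v|)%:E <= surface_area Om)%E.
Proof.
move=> n1; have m0 : (0 < n.-1)%N by rewrite -subn1 subn_gt0.
have [k k0 kE] := hausdorff_constE m0.
have C0 : 0 < 3 * 4 ^+ n :> R by rewrite !mulr_gt0// exprn_gt0.
exists (k / (3 * 4 ^+ n)); first by rewrite divr_gt0.
move=> Om v vOm v0 Omv.
(* The single scale [delta = |v|] suffices: it guarantees the hypothesis [D <= |v|] of [tube_volume]
   for every set of the cover. *)
apply: le_ereal_sup_tmp; exists (hausdorff_premeasure n.-1 `|v| (boundary Om)).
  by exists `|v|.
apply: le_ereal_inf_tmp => _ [c bc <-].
pose F j := tube v (oapp sval set0 (c j)).
have OmF : Om `<=` \bigcup_j F j.
  move=> x /Omv[t t01 bt]; have [j _ Fj] := bc _ bt.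
  by exists j => //; exists t.
have : (1 <= \sum_(j <oo) lebesgue_outer (F j))%E.
  rewrite -vOm; apply: le_trans (le_lebesgue_outer OmF) _.
  exact: cover_measure_sigma_subadditive (@box_volume_ge0 R n) _.
pose K := 3 * 4 ^+ n * `|v| / k.
have K0 : 0 < K by rewrite divr_gt0// mulr_gt0.
have w0 (o : option {B : set V | (diameter B <= `|v|%:E)%E}) :
    (0 <= oapp (fun B : {B : set V | diameter B <= `|v|%:E} =>
       hausdorff_const R n.-1 * diameter (sval B) ^+ n.-1) 0 o)%E.
  case: o => //= B; rewrite kE mule_ge0 ?lee_fin ?(ltW k0)//.
  by rewrite expe_ge0 ?diameter_ge0.
move=> H.
have {H} : (1 <= K%:E * \sum_(j <oo) oapp
    (fun B : {B : set V | diameter B <= `|v|%:E} =>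
       hausdorff_const R n.-1 * diameter (sval B) ^+ n.-1) 0 (c j))%E.
  apply: le_trans H _; rewrite -nneseriesZl; last by move=> j _; exact: w0.
  apply: lee_nneseries => [j _ _|j _]; first exact: cover_measure_ge0 (@box_volume_ge0 R n) _.
  rewrite /F; case: (c j) => [[B dB]|]/=; last first.
    rewrite mule0; have -> : tube v set0 = set0 by rewrite -subset0 => x [].
    by rewrite lebesgue_outer0.
  have [D [DE D0 DL BD]] := diameterE dB.
  rewrite DE kE -EFin_expe -!EFinM.
  have -> : K * (k * D ^+ n.-1) = 3 * 4 ^+ n * `|v| * D ^+ n.-1.
    by rewrite /K; field; rewrite gt_eqF.
  apply: tube_volume => //; first by rewrite D0.
  by move=> x y Bx By; apply: le_trans (norm_le_enorm _) (BD _ _ Bx By).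
have -> : k / (3 * 4 ^+ n) / `|v| = K^-1.
  by rewrite /K; field; rewrite !gt_eqF.
by rewrite -lee_pdivrMl// mule1.
Qed.

End hausdorff.

(** * The maximum principle *)

Section second_derivatives.
Variables (R : realType) (n : nat).
Local Notation V := 'rV[R]_n.
Implicit Types (x y v z e : V) (f g : V -> R).

Lemma is_derivePlim (W : normedModType R) (f : W -> R) (x v : W) (d : R) :
  is_derive x v f d <->
  h^-1 * (f (h *: v + x) - f x) @[h --> 0^'] --> d.
Proof.
split=> [[df <-]|fd]; first exact: df.
apply: DeriveDef; first by apply/cvg_ex; exists d.
exact: cvg_lim fd.
Qed.

Lemma is_derive_line f x v (t d : R) : is_derive (t *: v + x) v f d ->
  is_derive t 1 (fun s : R => f (s *: v + x)) d.
Proof.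
move=> /is_derivePlim fd; apply/is_derivePlim.
have -> : (fun h : R => h^-1 * (f ((h *: 1 + t) *: v + x) - f (t *: v + x))) =
    (fun h : R => h^-1 * (f (h *: v + (t *: v + x)) - f (t *: v + x))).
  by apply/funext => h; rewrite scalerDl -addrA [h *: 1]mulr1.
exact: fd.
Qed.

Lemma near_line (P : set V) x v : (\forall y \near x, P y) ->
  exists2 e : R, 0 < e & forall t, `|t| <= e -> P (t *: v + x).
Proof.
move=> /nbhs_cubeP[r r0 rP]; have v0 : 0 < `|v| + 1 by rewrite ltr_wpDl.
exists (r / (`|v| + 1)) => [|t te]; first exact: divr_gt0.
apply: rP; rewrite /cube /= addrK normrZ.
rewrite ler_pdivlMr// in te; apply: le_trans te.
by rewrite ler_wpM2l// lerDl.
Qed.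

(** A relation rather than an iterated [partial], so that sums, opposites and translates are handled
    without computing their first derivatives. *)
Definition has_d2 v f x (l : R) := exists2 g : V -> R,
  \forall y \near x, is_derive y v f (g y) & is_derive x v g l.

Lemma has_d2D v f g x (k l : R) : has_d2 v f x k -> has_d2 v g x l ->
  has_d2 v (fun y => f y + g y) x (k + l).
Proof.
move=> [f1 ff1 f1k] [g1 gg1 g1l]; exists (f1 \+ g1); last exact: is_deriveD.
near=> y; apply: is_deriveD; near: y.
  exact: ff1.
exact: gg1.
Unshelve. all: by end_near. Qed.

Lemma has_d2N v f x (k : R) : has_d2 v f x k -> has_d2 v (fun y => - f y) x (- k).
Proof.
move=> [f1 ff1 f1k]; exists (\- f1); last exact: is_deriveN.
near=> y; apply: is_deriveN; near: y; exact: ff1.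
Unshelve. all: by end_near. Qed.

Lemma has_d2_shift v f x e (k : R) : has_d2 v f (x + e) k ->
  has_d2 v (fun y => f (y + e)) x k.
Proof.
have shift_is_derive (h : V -> R) y l : is_derive (y + e) v h l ->
    is_derive y v (fun y => h (y + e)) l.
  move=> /is_derivePlim hl; apply/is_derivePlim.
  have -> : (fun h0 : R => h0^-1 * (h (h0 *: v + y + e) - h (y + e))) =
      (fun h0 : R => h0^-1 * (h (h0 *: v + (y + e)) - h (y + e))).
    by apply/funext => h0; rewrite addrA.
  exact: hl.
move=> [f1 ff1 f1k]; exists (fun y => f1 (y + e)); last exact: shift_is_derive.
have /nbhs_cubeP[r r0 rP] := ff1; apply/nbhs_cubeP; exists r => // y xy.
apply: shift_is_derive; apply: rP.
by rewrite /cube /= opprD addrACA subrr addr0.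
Qed.

(** Covers all barriers and the perturbation of the maximum principle; as [c] does not depend on
    [y], the slope [b] is affine along [v]. *)
Lemma has_d2_quadratic v f x (b : V -> R) (c : R) :
  (forall y (h : R), f (h *: v + y) = f y + h * b y + h ^+ 2 * c) ->
  has_d2 v f x (2 * c).
Proof.
move=> fE.
have lin (a k : R) : h^-1 * (h * a + h ^+ 2 * k) @[h --> 0^'] --> a.
  have : a + h * k @[h --> 0^'] --> a + 0 * k.
    apply: cvgD; first exact: cvg_cst.
    apply: cvgM; last exact: cvg_cst.
    by move=> A /nbhs_dnbhs.
  rewrite mul0r addr0; apply: cvg_trans; apply: near_eq_cvg.
  near=> h; have h0 : h != 0 by near: h; exact: nbhs_dnbhs_neq.
  by field.
have df y : is_derive y v f (b y).
  apply/is_derivePlim; have := lin (b y) c.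
  apply: cvg_trans; apply: near_eq_cvg; near=> h.
  by rewrite fE; congr (_ * _); ring.
exists b; first by near=> y; exact: df.
have bE h : b (h *: v + x) = b x + h * (2 * c).
  (* evaluate [f] at [x + (h + k) v] in two ways *)
  have H (k : R) : k != 0 -> b (h *: v + x) = b x + h * (2 * c).
    move=> k0; apply: (mulfI k0).
    have := fE (h *: v + x) k; rewrite addrA -scalerDl !fE.
    move=> H; lra.
  exact: (H 1 (oner_neq0 _)).
apply/is_derivePlim; have := lin (2 * c) 0.
apply: cvg_trans; apply: near_eq_cvg; near=> h.
by rewrite bE; congr (_ * _); ring.
Unshelve. all: by end_near. Qed.

(** At a maximum the first derivative vanishes; were [l] positive, it would be positive just after,
    and [f] would increase by the mean value theorem. *)
Lemma has_d2_max v f x (l : R) : has_d2 v f x l ->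
  (\forall y \near x, f y <= f x) -> l <= 0.
Proof.
move=> [g fg gl] fmax; rewrite leNgt; apply/negP => l0.
have [e e0 eP] := near_line v (filterI fg fmax).
pose p (t : R) := f (t *: v + x); pose q (t : R) := g (t *: v + x).
have dp (t : R) : `|t| <= e -> is_derive t (1 : R) p (q t).
  by move=> /eP[ft _]; exact: is_derive_line.
have p0 : p 0 = f x by rewrite /p scale0r add0r.
have q0 : q 0 = 0.
  have e00 : `|0 : R| <= e by rewrite normr0 ltW.
  have inI t : t \in `](- e), e[ -> `|t| <= e.
    by rewrite in_itv /= ler_norml => /andP[h1 h2]; rewrite !ltW.
  have [||||_ dmax] := @derive1_at_max R p (- e) e 0.
  - lra.
  - by move=> t /inI/dp[].
  - by rewrite in_itv /=; apply/andP; split; lra.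
  - by move=> t /inI/eP[_]; rewrite p0.
  by have [_ <-] := dp 0 e00.
have /is_derivePlim := gl; have -> : g x = 0 by rewrite -q0 /q scale0r add0r.
move=> gcvg; have := cvgr_gt _ gcvg _ l0.
move=> /(_ _)/nbhs_ballP[r /= r0 rP].
have qpos t : 0 < t -> t < r -> 0 < q t.
  move=> t0 tr; have := rP t; rewrite -ball_normE /= sub0r normrN gtr0_norm//.
  move=> /(_ tr); rewrite gt_eqF// => /(_ isT).
  by rewrite subr0 pmulr_rgt0 ?invr_gt0.
pose t := Num.min e (r / 2).
have t0 : 0 < t by rewrite lt_min e0 divr_gt0.
have te : t <= e by rewrite ge_min lexx.
have tr : t < r by apply: (@le_lt_trans _ _ (r / 2)); [rewrite ge_min lexx orbT|lra].
have inI s : 0 <= s <= t -> `|s| <= e by move=> /andP[s0 st]; rewrite ger0_norm//; lra.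
have [||c] := @MVT R p q 0 t t0.
- by move=> s; rewrite in_itv /= => /andP[s0 st]; apply: dp; apply: inI; rewrite !ltW.
- apply: derivable_within_continuous => s; rewrite in_itv /= => /inI/dp[].
  by [].
rewrite in_itv /= => /andP[c0 ct] pE.
have tt : 0 <= t <= t by rewrite lexx ltW.
have [_] := eP t (inI t tt).
rewrite -p0 -subr_le0 -/(p t) pE subr0; apply/negP; rewrite -ltNge.
by rewrite mulr_gt0// qpos//; lra.
Qed.

Lemma dot_delta y i : dot y (delta_mx ord0 i) = y ord0 i.
Proof.
rewrite /dot (bigD1 i)//= mxE !eqxx mulr1 big1 ?addr0// => j /negPf ji.
by rewrite mxE ji andbF mulr0.
Qed.

(** Adding [e * |y| ^ 2] makes the Laplacian positive, so that the maximum is not in [V0]; then [e]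
    tends to 0. The pair [K], [V0] is general so as to include part of a domain and the intersection
    of two translates. *)
Lemma max_principle (K V0 : set V) f (L : V -> 'I_n -> R) (c : R) : (0 < n)%N ->
  compact K -> open V0 -> V0 `<=` K -> {within K, continuous f} ->
  (forall x, V0 x -> forall i, has_d2 (delta_mx ord0 i) f x (L x i)) ->
  (forall x, V0 x -> 0 <= \sum_i L x i) ->
  (forall x, K x -> ~ V0 x -> f x <= c) -> forall x, K x -> f x <= c.
Proof.
move=> n0 cK oV0 V0K fc fL L0 fbd x Kx.
pose q y := dot (y - 0) (y - 0).
have qc : {within K, continuous q} by apply: continuous_subspaceT; exact: continuous_sqdist.
have [|m Km qm] := @EVT_max_rV R n q K _ cK qc; first by exists x.
have q0 y : 0 <= q y by exact: dot_ge0.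
suff H (e : R) : 0 < e -> f x <= c + e * q m.
  apply/ler_addgt0Pr => e e0.
  have qm1 : 0 < q m + 1 by rewrite ltr_wpDl.
  apply: le_trans (H (e / (q m + 1)) _) _; first exact: divr_gt0.
  rewrite lerD2l mulrAC ler_pdivrMr// ler_pM2l// lerDl.
  exact: ler01.
move=> e0; pose g y := f y + e * q y.
have gc : {within K, continuous g}.
  move=> y; apply: cvgD; first exact: fc.
  by apply: cvgM; [exact: cvg_cst|exact: qc].
have [|z Kz zmax] := @EVT_max_rV R n g K _ cK gc; first by exists x.
rewrite inE in Kz.
have gx : g x <= g z by apply: zmax; rewrite inE.
have fgx : f x <= g x by rewrite lerDl mulr_ge0// ltW.
have qz : q z <= q m by apply: qm; rewrite inE.
apply: le_trans fgx (le_trans gx _).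
rewrite /g; apply: lerD; last by rewrite ler_pM2l.
apply: fbd => // Vz.
have gd2 i : has_d2 (delta_mx ord0 i) g z (L z i + e * 2).
  apply: has_d2D; first exact: fL.
  have := @has_d2_quadratic (delta_mx ord0 i) (fun y => e * q y) z
    (fun y => e * (2 * y ord0 i)) e.
  rewrite mulrC; apply => y h.
  rewrite /q !subr0 addrC dot_sqrD dotZr dotZl dotZr.
  rewrite !dot_delta mxE !eqxx /=; ring.
have Lneg i : L z i + e * 2 <= 0.
  apply: has_d2_max (gd2 i) _.
  have := open_nbhs_nbhs (conj oV0 Vz); apply: filterS => y /V0K Ky.
  by apply: zmax; rewrite inE.
have : \sum_i (L z i + e * 2) <= 0 by apply: sumr_le0 => i _; exact: Lneg.
rewrite big_split /= sumr_const card_ord; have := L0 z Vz.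
have : 0 < (e * 2) *+ n by rewrite pmulrn_lgt0// mulr_gt0.
lra.
Qed.

End second_derivatives.

(** * Estimates of the torsion function *)

Section torsion_estimates.
Variables (R : realType) (n : nat).
Local Notation V := 'rV[R]_n.
Implicit Types (x y v z e w : V) (Om : set V) (u : V -> R).

Lemma torsion_has_d2 Om u x i : open Om -> C2_on Om u -> Om x ->
  has_d2 (delta_mx ord0 i) u x (partial i (partial i u) x).
Proof.
move=> oOm C2 Ox; exists (partial i u).
  have := open_nbhs_nbhs (conj oOm Ox); apply: filterS => y Oy.
  by have [du _ _ _] := C2 y Oy i i; exact: derivableP du.
by have [_ _ du _] := C2 x Ox i i; exact: derivableP du.
Qed.

Lemma has_d2_dot w z (a b : R) x i :
  has_d2 (delta_mx ord0 i) (fun y => a * dot w (y - z) + b * dot w (y - z) ^+ 2) x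
    (2 * (b * w ord0 i ^+ 2)).
Proof.
apply: (@has_d2_quadratic _ _ _ _ _
  (fun y => a * w ord0 i + b * (2 * dot w (y - z) * w ord0 i))) => y h.
have -> : dot w (h *: delta_mx ord0 i + y - z) = h * w ord0 i + dot w (y - z).
  by rewrite -[_ + y - z]addrA (dotDr w (h *: _)) dotZr dot_delta.
ring.
Qed.

Lemma closure_le Om (f : V -> R) (c : R) : continuous f ->
  (forall x, Om x -> f x <= c) -> forall x, closure Om x -> f x <= c.
Proof.
move=> fc fOm x cx; rewrite leNgt; apply/negP => cf.
have [y [Oy /=]] := cx _ (cvgr_gt _ (fc x) _ cf).
by rewrite ltNge fOm.
Qed.

Lemma continuous_dotB w z : continuous (fun y => dot w (y - z)).
Proof.
have -> : (fun y => dot w (y - z)) = (fun y => dot w y - dot w z).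
  by apply/funext => y; rewrite dotBr.
by move=> y; exact: cvgB (@continuous_dot R n _ y) (cvg_cst _).
Qed.

Lemma continuous_quadratic w z (a b : R) :
  continuous (fun y => a * dot w (y - z) + b * dot w (y - z) ^+ 2).
Proof.
have h1 : continuous (fun y => a * dot w (y - z)).
  by move=> y; exact: cvgM (cvg_cst _) (@continuous_dotB w z y).
have h2 : continuous (fun y => dot w (y - z) ^+ 2).
  by move=> y; exact: cvgM (@continuous_dotB w z y) (@continuous_dotB w z y).
have h3 : continuous (fun y => b * dot w (y - z) ^+ 2).
  by move=> y; exact: cvgM (cvg_cst _) (h2 y).
by move=> y; exact: cvgD (h1 y) (h3 y).
Qed.

Section domain.
Variables (Om : set V) (u : V -> R) (D : R).
Hypotheses (n0 : (0 < n)%N) (oOm : open Om) (tu : torsion_function Om u).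
Hypothesis OmD : forall x, Om x -> `|x| <= D.

Lemma torsion_boundary0 x : closure Om x -> ~ Om x -> u x = 0.
Proof. by case: tu => _ _ _ bu cx nx; apply: bu; exact/boundaryP. Qed.

Lemma torsion_within : {within closure Om, continuous u}.
Proof. by case: tu. Qed.

Lemma torsion_d2 x i : Om x ->
  has_d2 (delta_mx ord0 i) u x (partial i (partial i u) x).
Proof. by case: tu => _ C2 _ _; exact: torsion_has_d2. Qed.

Lemma torsion_lap x : Om x -> \sum_i partial i (partial i u) x = -1.
Proof.
by case: tu => _ _ lu _ /lu; rewrite /laplacian => <-; rewrite opprK.
Qed.

Lemma torsion_ge0 x : closure Om x -> 0 <= u x.
Proof.
move=> cx; rewrite -oppr_le0; move: x cx.
apply: (@max_principle R n (closure Om) Om (fun y => - u y)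
  (fun x i => - partial i (partial i u) x) 0 n0 (compact_closure OmD) oOm) => //.
- exact: subset_closure.
- by move=> y; apply: cvgN; exact: torsion_within.
- by move=> x Ox i; apply: has_d2N; exact: torsion_d2.
- by move=> x Ox; rewrite sumrN torsion_lap// opprK.
- by move=> x cx nx; rewrite torsion_boundary0// oppr0.
Qed.

Lemma torsion_slab w p : w != 0 -> (forall x, Om x -> `|dot w (x - p)| <= 2) ->
  forall x, closure Om x -> u x <= 2 / enorm w ^+ 2.
Proof.
move=> w0 wOm; have W0 := enorm_gt0 w0; set W := enorm w in W0 *.
have dc := @continuous_dotB w p.
(* barrier [(4 - s ^+ 2) / (2 * W ^+ 2)] with [s := dot w (y - p)] *)
pose b : R := (2 * W ^+ 2)^-1.
pose f y := u y + (0 * dot w (y - p) + b * dot w (y - p) ^+ 2).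
suff H x : closure Om x -> f x <= 2 / W ^+ 2.
  move=> x /H; apply: le_trans; rewrite lerDl mul0r add0r.
  by rewrite mulr_ge0 ?sqr_ge0// invr_ge0 mulr_ge0// sqr_ge0.
move: x; apply: (@max_principle R n (closure Om) Om f
  (fun x i => partial i (partial i u) x + 2 * (b * w ord0 i ^+ 2)) _ n0
  (compact_closure OmD) oOm).
- exact: subset_closure.
- move=> y; apply: cvgD; first exact: torsion_within.
  exact: (continuous_subspaceT (A := closure Om) (@continuous_quadratic w p 0 b)).
- by move=> x Ox i; apply: has_d2D; [exact: torsion_d2|exact: has_d2_dot].
- move=> x Ox; rewrite big_split /= torsion_lap// -mulr_sumr -mulr_sumr.
  have -> : \sum_i w ord0 i ^+ 2 = W ^+ 2.
    by rewrite sqr_enorm; apply: eq_bigr => i _; rewrite expr2.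
  rewrite /b le_eqVlt; apply/orP; left; apply/eqP; field.
  by rewrite gt_eqF.
- move=> x cx nx; rewrite /f torsion_boundary0// mul0r !add0r.
  have h : `|dot w (x - p)| <= 2.
    move: x cx {nx}; apply: closure_le => // y.
    by exact: cvg_norm (dc y).
  have {}h : dot w (x - p) ^+ 2 <= 4.
    by rewrite -real_normK ?num_real//; have := normr_ge0 (dot w (x - p)); nra.
  have -> : 2 / W ^+ 2 = b * 4 by rewrite /b; field; rewrite gt_eqF.
  by rewrite ler_wpM2l// invr_ge0 mulr_ge0// sqr_ge0.
Qed.

Lemma torsion_halfspace v z (h : R) : enorm v = 1 -> 0 < h ->
  (forall x, Om x -> 0 <= dot v (x - z)) ->
  (forall x, closure Om x -> u x <= h ^+ 2 / 2) ->
  forall x, closure Om x -> u x <= h * dot v (x - z).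
Proof.
move=> v1 h0 vOm uh.
pose s x := dot v (x - z).
have sc : continuous s by exact: continuous_dotB.
have s0 x : closure Om x -> 0 <= s x.
  rewrite -oppr_le0; move: x; apply: closure_le => [y|y Oy].
    by exact: cvgN (sc y).
  by rewrite oppr_le0; exact: vOm.
(* barrier [h * s - s ^+ 2 / 2], used where [s <= h] *)
pose f y := u y + ((- h) * dot v (y - z) + (1 / 2) * dot v (y - z) ^+ 2).
pose K := closure Om `&` [set x | s x <= h].
pose V0 := Om `&` [set x | s x < h].
have H x : K x -> f x <= 0.
  move: x; apply: (@max_principle R n K V0 f
    (fun x i => partial i (partial i u) x + 2 * ((1 / 2) * v ord0 i ^+ 2)) _ n0).
  - apply: compact_closedI; first exact: compact_closure OmD.
    apply: (@closed_comp _ _ s [set t | t <= h]); last exact: closed_le.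
    by move=> x _; exact: (@sc x).
  - apply: openI => //; apply: (@open_comp _ _ s [set t | t < h]); last exact: open_lt.
    by move=> x _; exact: (@sc x).
  - by move=> x [Ox sx]; split; [exact: closure_self|exact: ltW].
  - apply: (@continuous_subspaceW _ _ K (closure Om)); first exact: subIsetl.
    move=> y; apply: cvgD; first exact: torsion_within.
    exact: (continuous_subspaceT (A := closure Om)
      (@continuous_quadratic v z (- h) (1 / 2))).
  - by move=> x [Ox _] i; apply: has_d2D; [exact: torsion_d2|exact: has_d2_dot].
  - move=> x [Ox _]; rewrite big_split /= torsion_lap// -mulr_sumr -mulr_sumr.
    have -> : \sum_i v ord0 i ^+ 2 = enorm v ^+ 2.
      by rewrite sqr_enorm; apply: eq_bigr => i _; rewrite expr2.
    by rewrite v1; lra.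
  - move=> x [cx /= sx] nV.
    have := s0 x cx; rewrite /f -/(s x) => sx0.
    (* On the face [s = h] the barrier equals the given bound [h ^+ 2 / 2]; on the boundary of [Om],
       [u] vanishes and the barrier is nonnegative since [0 <= s <= h]. *)
    have [Ox|nx] := pselect (Om x).
      have sE : s x = h.
        apply/eqP; rewrite eq_le sx /= leNgt; apply/negP => sh.
        by apply: nV.
      rewrite sE; have := uh x cx; lra.
    rewrite torsion_boundary0//; nra.
move=> x cx; rewrite -/(s x).
have [sh|sh] := leP (s x) h.
  have := H x (conj cx sh); rewrite /f -/(s x); have := s0 x cx; nra.
have := uh x cx; nra.
Qed.

(** A supporting hyperplane at [y] is replaced by one through [y + t *: (y - x0)], which costs an
    error of order [t]; [C] is chosen so that this error is at most [e]. *)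
Lemma torsion_near_boundary x0 (r h : R) : convex Om -> 0 < r ->
  cube x0 r `<=` Om -> 0 < h -> (forall x, closure Om x -> u x <= h ^+ 2 / 2) ->
  forall x y, closure Om x -> boundary Om y -> u x <= h * (n%:R * `|x - y|).
Proof.
move=> cOm r0 rOm h0 uh x y cx bY.
pose C := h * (n%:R * (`|y - x0| + 1)).
have C0 : 0 < C by rewrite !mulr_gt0// ?ltr0n// ltr_wpDl.
apply/ler_addgt0Pr => e e0; pose t := e / C.
have t0 : 0 < t by rewrite divr_gt0.
have [v v1 vOm] := separation cOm r0 rOm OmD (boundary_outside cOm oOm r0 rOm bY t0).
apply: le_trans (torsion_halfspace v1 h0 vOm uh cx) _.
have eE : e = t * C by rewrite divfK// gt_eqF.
apply: le_trans (ler_wpM2l (ltW h0) (le_trans (ler_norm _) (dot_le_norm _ _))) _.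
rewrite v1 mulr1 {1}eE /C.
have H : `|x - (y + t *: (y - x0))| <= `|x - y| + t * `|y - x0|.
  rewrite opprD addrA; apply: le_trans (ler_normB _ _) _.
  by rewrite normrZ gtr0_norm.
apply: (@le_trans _ _ (h * (n%:R * (`|x - y| + t * `|y - x0|)))).
  by rewrite ler_pM2l// ler_wpM2l.
have -> : t * (h * (n%:R * (`|y - x0| + 1))) =
  h * (n%:R * (t * `|y - x0|)) + t * (h * n%:R) by ring.
have -> : h * (n%:R * (`|x - y| + t * `|y - x0|)) =
  h * (n%:R * `|x - y|) + h * (n%:R * (t * `|y - x0|)) by ring.
have th : 0 <= t * (h * n%:R).
  by apply: mulr_ge0; [exact: ltW|apply: mulr_ge0; [exact: ltW|exact: ler0n]].
by rewrite addrA lerDl.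
Qed.

(* The difference of two translates of [u] is harmonic. *)
Lemma torsion_lipschitz x0 (r h : R) : convex Om -> 0 < r ->
  cube x0 r `<=` Om -> 0 < h -> (forall x, closure Om x -> u x <= h ^+ 2 / 2) ->
  forall x e, Om x -> Om (x + e) -> u (x + e) - u x <= h * (n%:R * `|e|).
Proof.
move=> cOm r0 rOm h0 uh x e Ox Oxe.
have nb := torsion_near_boundary cOm r0 rOm h0 uh.
pose K := closure Om `&` [set y | closure Om (y + e)].
pose V0 := Om `&` [set y | Om (y + e)].
have ec : continuous (fun y => y + e).
  by move=> y; exact: cvgD cvg_id (cvg_cst _).
suff H y : K y -> u (y + e) + - u y <= h * (n%:R * `|e|).
  by apply: H; split; exact: closure_self.
move: y; apply: (@max_principle R n K V0 _
  (fun x i => partial i (partial i u) (x + e) - partial i (partial i u) x) _ n0).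
- apply: compact_closedI; first exact: compact_closure OmD.
  apply: (@closed_comp _ _ (fun y => y + e) (closure Om)); last exact: closed_closure.
  by move=> y _; exact: (@ec y).
- apply: openI => //; apply: (@open_comp _ _ (fun y => y + e) Om) oOm => y _.
  exact: ec.
- by move=> y [Oy Oye]; split; exact: closure_self.
- have K1 : {within K, continuous u}.
    by apply: (@continuous_subspaceW _ _ K (closure Om)) torsion_within; exact: subIsetl.
  have K2 : {within K, continuous (fun y => u (y + e))}.
    apply/subspace_continuousP => y [cy cye].
    have /subspace_continuousP/(_ _ cye) := torsion_within.
    apply: cvg_trans => A; rewrite /= /within /= !nbhs_simpl /=.
    move=> H; have := ec y _ H; rewrite nbhs_simpl /=.
    by apply: filterS => t At [_ ct]; exact: At.
  by move=> y; apply: cvgD; [exact: K2|apply: cvgN; exact: K1].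
- move=> y [Oy Oye] i; apply: has_d2D; first exact/has_d2_shift/torsion_d2.
  exact/has_d2N/torsion_d2.
- by move=> y [Oy Oye]; rewrite sumrB (torsion_lap Oye) (torsion_lap Oy) subrr.
- move=> y [cy cye] nV; have e0 : 0 <= h * (n%:R * `|e|).
    by rewrite !mulr_ge0// ltW.
  (* If [y] is a boundary point, then [u y = 0] and [y + e] is within [|e|] of the boundary. If
     instead [y + e] is one, the difference is [- u y], which is at most 0. *)
  have [Oy|nOy] := pselect (Om y); last first.
    rewrite (torsion_boundary0 cy nOy) oppr0 addr0.
    have := nb (y + e) y cye ((boundaryP y oOm).2 (conj cy nOy)).
    have -> // : y + e - y = e by rewrite addrAC subrr add0r.
  rewrite (torsion_boundary0 cye) ?add0r; last by move=> Oye; apply: nV.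
  by apply: le_trans e0; rewrite oppr_le0 torsion_ge0.
Qed.

(** One factor [n] is in the Lipschitz constant, the other comes from comparing the Euclidean and
    sup norms of the gradient. *)
Lemma torsion_gradient x0 (r h : R) : convex Om -> 0 < r ->
  cube x0 r `<=` Om -> 0 < h -> (forall x, closure Om x -> u x <= h ^+ 2 / 2) ->
  forall x, Om x -> enorm (gradient u x) <= n%:R ^+ 2 * h.
Proof.
move=> cOm r0 rOm h0 uh x Ox.
have lip := torsion_lipschitz cOm r0 rOm h0 uh.
apply: le_trans (enorm_le_norm _) _.
have -> : n%:R ^+ 2 * h = n%:R * (h * n%:R) by ring.
rewrite ler_wpM2l//; apply/norm_coord_le => [|i]; first by rewrite mulr_ge0// ltW.
rewrite mxE /partial.
have du : derivable u x (delta_mx ord0 i).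
  by case: tu => _ C2 _ _; have [] := C2 x Ox i i.
have /is_derivePlim/cvg_norm := derivableP du.
move=> /cvgr_to_le; apply.
have [e e0 eP] := near_line (delta_mx ord0 i) (open_nbhs_nbhs (conj oOm Ox)).
have dn : `|delta_mx ord0 i : V| <= 1.
  apply/norm_coord_le => // j; rewrite mxE; case: (_ && _) => /=.
    by rewrite normr1.
  by rewrite normr0.
near=> t.
have t0 : t != 0 by near: t; exact: nbhs_dnbhs_neq.
have te : `|t| <= e by near: t; exact: dnbhs0_le.
have Oxt := eP t te.
rewrite normrM normfV mulrC ler_pdivrMr ?normr_gt0//.
have tb : h * (n%:R * `|t *: (delta_mx ord0 i : V)|) <= h * n%:R * `|t|.
  rewrite mulrA ler_wpM2l ?mulr_ge0 ?(ltW h0)// normrZ.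
  by rewrite ler_piMr.
have hi : u (t *: delta_mx ord0 i + x) - u x <= h * n%:R * `|t|.
  apply: le_trans tb; rewrite addrC [t *: _ + x]addrC addrC; apply: lip => //.
  by rewrite addrC.
have lo : u x - u (t *: delta_mx ord0 i + x) <= h * n%:R * `|t|.
  apply: le_trans tb; rewrite -normrN.
  have xE : (t *: delta_mx ord0 i + x) + - (t *: delta_mx ord0 i) = x.
    by rewrite addrAC subrr add0r.
  by rewrite -{1}xE; apply: lip => //; rewrite xE.
by rewrite ler_norml; apply/andP; split; lra.
Unshelve. all: by end_near. Qed.

End domain.
End torsion_estimates.

(** * Blaschke selection *)

Section blaschke.
Variables (R : realType) (n : nat).
Local Notation V := 'rV[R]_n.
Implicit Types (A B L : set V) (x y z v : V).

Definition within_dist (e : R) A B := forall x, A x -> exists2 y, B y & `|x - y| <= e.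

Lemma finite_net (M e : R) : 0 <= M -> 0 < e ->
  exists F : seq V, forall x, `|x| <= M -> exists2 f, f \in F & `|x - f| <= e.
Proof.
move=> M0 e0; pose A : set V := [set x | `|x| <= M].
pose C := ((2 * (M + e)) ^+ n) / (e ^+ n).
have [|F [_ _ FA]] := @maximal_separated R n A e (Num.truncn C).
  move=> s sA ps; have Me : 0 <= M + e by rewrite addr_ge0// ltW.
  rewrite truncn_ge_nat; last first.
    by rewrite divr_ge0 ?exprn_ge0 ?mulr_ge0//; exact: ltW.
  rewrite ler_pdivlMr ?exprn_gt0// -lee_fin.
  rewrite -(lebesgue_outer_cube (0 : V) Me).
  have := @packing R n (cube 0 (M + e)) set0 s (e / 2).
  rewrite lebesgue_outer0 adde0 [2 * (e / 2)]mulrC divfK//; apply => //.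
  - by rewrite divr_ge0// ltW.
  - move=> c /sA cM x; rewrite /cube /= subr0 => xc.
    rewrite -[x](subrK c); apply: le_trans (ler_normD _ _) _.
    rewrite /A /= in cM; lra.
  - by move=> c _; rewrite setI0.
by exists F.
Qed.

Variables (Om : nat -> set V) (U : set_system nat) (M r : R).
Hypotheses (uU : UltraFilter U) (cOm : forall k, convex (Om k)) (r0 : 0 < r)
  (rOm : forall k, cube 0 r `<=` Om k) (OmM : forall k x, Om k x -> `|x| <= M).

Lemma Om0 k : Om k 0.
Proof. by apply: (cube_center (ltW r0)). Qed.

Lemma M_ge0 : 0 <= M.
Proof. by have := OmM (Om0 0); rewrite normr0. Qed.

(** For each of the finitely many points of a net the ultrafilter decides whether the domains come
    near it. On the resulting set of indices all domains are near the same points of the net. *)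
Lemma ultra_close (e : R) : 0 < e ->
  exists2 S, U S & forall j k, S j -> S k -> within_dist e (Om j) (Om k).
Proof.
move=> e0; have FU : ProperFilter U by exact: ultra_proper.
have e2 : 0 < e / 2 by rewrite divr_gt0.
have [F Fnet] := finite_net M_ge0 e2.
pose near_to f k := exists2 x, Om k x & `|x - f| <= e / 2.
have [S US HS] : exists2 S, U S & forall j k, S j -> S k -> forall f, f \in F ->
    near_to f j -> near_to f k.
  elim: F {Fnet} => [|f F [S US HS]]; first by exists setT => //; exact: filterT.
  have [Uf|Uf] := in_ultra_setVsetC [set k | near_to f k] uU.
    exists (S `&` [set k | near_to f k]); first exact: filterI.
    move=> j k [Sj _] [Sk fk] g; rewrite inE => /orP[/eqP->//|gF].
    exact: HS.
  exists (S `&` ~` [set k | near_to f k]); first exact: filterI.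
  move=> j k [Sj fj] [Sk _] g; rewrite inE => /orP[/eqP-> //|gF].
  exact: HS.
exists S => // j k Sj Sk x Ox.
have [f fF xf] := Fnet x (OmM Ox).
have [|y Oy yf] := HS j k Sj Sk f fF; first by exists x.
exists y => //; have -> : x - y = (x - f) - (y - f) by rewrite opprB addrA subrK.
apply: le_trans (ler_normB _ _) _; lra.
Qed.

(** An approximation from inside, because the limit has to be open. *)
Definition ultra_limit : set V :=
  [set x | exists2 e : R, 0 < e & U [set k | cube x e `<=` Om k]].

Lemma ultra_limit0 : ultra_limit 0.
Proof.
exists r => //; have FU : ProperFilter U by exact: ultra_proper.
by apply: filterS filterT => k _; exact: rOm.
Qed.

Lemma ultra_limit_open : open ultra_limit.
Proof.
have FU : ProperFilter U by exact: ultra_proper.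
apply/openP => x [e e0 Ue]; exists (e / 2); first exact: divr_gt0.
move=> y xy; exists (e / 2); first exact: divr_gt0.
apply: filterS Ue => k xk z yz; apply: xk.
rewrite /cube /= in xy yz *.
rewrite -(subrKA y); apply: le_trans (ler_normD _ _) _; lra.
Qed.

Lemma ultra_limit_convex : convex ultra_limit.
Proof.
have FU : ProperFilter U by exact: ultra_proper.
move=> x y t [e e0 Ue] [d d0 Ud] t01.
exists (Num.min e d); first by rewrite lt_min e0.
apply: filterS (filterI Ue Ud) => k [xk yk] z; rewrite /cube /= => zxy.
pose w := z - (t *: x + (1 - t) *: y).
have -> : z = t *: (x + w) + (1 - t) *: (y + w).
  by apply/rowP => i; rewrite !mxE; ring.
have we : `|w| <= e by apply: le_trans zxy _; rewrite ge_min lexx.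
have wd : `|w| <= d by apply: le_trans zxy _; rewrite ge_min lexx orbT.
by apply: cOm => //; [apply: xk|apply: yk]; rewrite /cube /= addrC addKr.
Qed.

(* Shrinking a member of a close pair towards the common centre puts it inside
   the other member, with some room. *)
Lemma ultra_limit_close (e : R) : 0 < e ->
  U [set k | within_dist e (Om k) ultra_limit /\ within_dist e ultra_limit (Om k)].
Proof.
have FU : ProperFilter U by exact: ultra_proper.
move=> e0; have M0 := M_ge0.
have rp : 0 < r by exact: r0.
have M1 : 0 < M + 1 by lra.
(* Shrinking by [1 - s] moves points by at most [s * M <= e] and creates room [s * r]; half of this
   room pays for passing to another domain, the other half remains. *)
pose s := Num.min 1 (e / (M + 1)).
have s0 : 0 < s by rewrite lt_min ltr01 divr_gt0.
have s1 : s <= 1 by rewrite ge_min lexx.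
have sM : s * M <= e.
  have : s <= e / (M + 1) by rewrite ge_min lexx orbT.
  rewrite ler_pdivlMr//; nra.
pose d := Num.min e (s * r / 2).
have sr : 0 < s * r by rewrite mulr_gt0.
have d0 : 0 < d by rewrite lt_min e0 divr_gt0.
have de : d <= e by rewrite ge_min lexx.
have dsr : d <= s * r / 2 by rewrite ge_min lexx orbT.
have [S US HS] := ultra_close d0.
apply: filterS (US) => j Sj; split => x.
  move=> Ox; exists ((1 - s) *: x); last first.
    have -> : x - (1 - s) *: x = s *: x by apply/rowP => i; rewrite !mxE; ring.
    rewrite normrZ gtr0_norm//; apply: le_trans sM.
    by rewrite ler_pM2l//; exact: OmM Ox.
  exists (s * r / 2); first exact: divr_gt0.
  apply: filterS US => k Sk w; rewrite /cube /= => wx.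
  have [z Oz xz] := HS j k Sj Sk x Ox.
  apply: (convex_cube (@cOm k) r0 (@rOm k) Oz (s := s)); first by rewrite s0.
  have -> : w - ((1 - s) *: z + s *: 0) = (w - (1 - s) *: x) + (1 - s) *: (x - z).
    by apply/rowP => i; rewrite !mxE; ring.
  apply: le_trans (ler_normD _ _) _.
  have : `|(1 - s) *: (x - z)| <= `|x - z|.
    by rewrite normrZ ger0_norm ?subr_ge0// ler_piMl//; lra.
  lra.
(* A point of the limit belongs to some [Om i] with [S i], which is close to [Om j]. *)
move=> [c c0 Uc]; have [i [Si xi]] := filter_ex (filterI US Uc).
have [|y Oy xy] := HS i j Si Sj x; first exact: cube_center (ltW c0) xi.
by exists y => //; lra.
Qed.

End blaschke.

Section selection.
Variables (R : realType) (n : nat).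
Local Notation V := 'rV[R]_n.

Lemma blaschke_selection (Om : nat -> set V) (M r : R) :
  (forall k, convex (Om k)) -> 0 < r -> (forall k, cube 0 r `<=` Om k) ->
  (forall k x, Om k x -> `|x| <= M) ->
  exists (phi : nat -> nat) (L : set V),
    [/\ forall i j, (i < j)%N -> (phi i < phi j)%N, open L, L !=set0, convex L &
      forall k, within_dist (k.+1%:R^-1) (Om (phi k)) L /\
        within_dist (k.+1%:R^-1) L (Om (phi k))].
Proof.
move=> cOm r0 rOm OmM.
have [U [uU NU]] := @ultraFilterLemma nat (nbhs \oo) _.
have FU : ProperFilter U by exact: ultra_proper.
pose L := ultra_limit Om U.
pose T m := [set k | within_dist (m.+1%:R^-1) (Om k) L /\
        within_dist (m.+1%:R^-1) L (Om k)].
(* The ultrafilter contains all tails, so each [T m] is unbounded; this makes the recursive choice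
   [phi] strictly increasing. *)
have [f Tf] : {f : nat -> nat -> nat & forall m N, T m (f m N) /\ (N < f m N)%N}.
  suff H m : {g : nat -> nat & forall N, T m (g N) /\ (N < g N)%N}.
    by exists (fun m => projT1 (H m)) => m; exact: projT2 (H m).
  apply: (@choice _ _ (fun N k => T m k /\ (N < k)%N)) => N.
  have m0 : 0 < m.+1%:R^-1 :> R by rewrite invr_gt0 ltr0n.
  have UT := ultra_limit_close uU cOm r0 rOm OmM m0.
  have UN : U [set k | (N < k)%N] by apply: NU; exact: nbhs_infty_gt.
  exact: filter_ex (filterI UT UN).
pose phi := fix phi m := if m is m'.+1 then f m'.+1 (phi m') else f 0%N 0%N.
exists phi, L; split.
- apply: (@homo_ltn _ phi (fun a b => (a < b)%N)) => [y x z|i].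
  exact: ltn_trans.
  exact: (Tf i.+1 (phi i)).2.
- exact: ultra_limit_open.
- by exists 0; exact: (ultra_limit0 uU r0).
- exact: ultra_limit_convex.
- by case=> [|k]; [exact: (Tf 0%N 0%N).1|exact: (Tf k.+1 (phi k)).1].
Qed.

Lemma hausdorff_dist_le (e : R) (A B : set V) : within_dist e A B ->
  within_dist e B A -> (hausdorff_dist A B <= (n%:R * e)%:E)%E.
Proof.
move=> AB BA; rewrite /hausdorff_dist ge_max; apply/andP; split.
  apply: ge_ereal_sup => _ [a Aa <-]; have [b Bb ab] := AB _ Aa.
  apply: (@le_trans _ _ (enorm (a - b))%:E).
    by apply: ereal_inf_lbound; exists b.
  by rewrite lee_fin (le_trans (enorm_le_norm _))// ler_wpM2l.
apply: ge_ereal_sup => _ [b Bb <-]; have [a Aa ab] := BA _ Bb.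
apply: (@le_trans _ _ (enorm (a - b))%:E).
  by apply: ereal_inf_lbound; exists a.
by rewrite lee_fin (le_trans (enorm_le_norm _))// ler_wpM2l// distrC.
Qed.

Lemma hausdorff_dist_ge0 (A B : set V) : A !=set0 -> (0 <= hausdorff_dist A B)%E.
Proof.
move=> [a Aa]; rewrite /hausdorff_dist le_max; apply/orP; left.
apply: le_trans (ereal_sup_ubound _); last by exists a; [exact: Aa|reflexivity].
by apply: le_ereal_inf_tmp => _ [b _ <-]; rewrite lee_fin enorm_ge0.
Qed.

Lemma hausdorff_dist_cvg0 (A : nat -> set V) L : (forall k, A k !=set0) ->
  (forall k, within_dist (k.+1%:R^-1) (A k) L /\ within_dist (k.+1%:R^-1) L (A k)) ->
  hausdorff_dist (A k) L @[k --> \oo] --> 0%E.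
Proof.
move=> A0 AL.
apply: (@squeeze_cvge _ _ _ _ (fun=> 0%E) _ (fun k => (n%:R * k.+1%:R^-1 : R)%:E)).
- apply: nearW => k; rewrite hausdorff_dist_ge0//=.
  by apply: hausdorff_dist_le; [exact: (AL k).1|exact: (AL k).2].
- exact: cvg_cst.
- apply: cvg_EFin; first exact: nearW.
  rewrite -[X in _ --> X](mulr0 n%:R).
  exact: cvgM (cvg_cst _) (@cvg_harmonic R).
Qed.

End selection.

(** * The theorem *)

Section power_bound.
Variable R : realType.

Lemma limn_einf_gt0 (f : nat -> \bar R) : (0 < limn_einf f)%E ->
  exists (c : R) (K : nat), 0 < c /\ forall k, (K <= k)%N -> (c%:E <= f k)%E.
Proof.
rewrite limn_einf_lim (cvg_lim _ (@cvg_einfs_sup R f))//.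
move=> /ereal_sup_gtP[_ [K _ <-] f0].
have [c c0 cf] : exists2 c : R, 0 < c & (c%:E <= einfs f K)%E.
  case: (einfs f K) f0 => [c c0|_|//]; first by exists c; rewrite ?lte_fin in c0 *.
  by exists 1; rewrite ?leey.
exists c, K; split => // k Kk; apply: le_trans cf _.
by apply: ereal_inf_lbound; exists k.
Qed.

Lemma product_lower_bound (p c C G delta : R) : p < 1 -> 0 < c -> 0 < C -> 0 < G ->
  0 < delta -> exists2 h0, 0 < h0 & forall (h : R) (a g : \bar R), 0 < h ->
    ((c / h)%:E <= a)%E -> (a <= (C / h)%:E)%E -> (g <= (G * h)%:E)%E ->
    (delta%:E <= a `^ p * g)%E -> h0 <= h.
Proof.
move=> p1 c0 C0 G0 d0.
pose Q := (C `^ p + c `^ p) * G.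
have Q0 : 0 < Q by rewrite mulr_gt0// addr_gt0// powR_gt0.
have q0 : 0 < 1 - p by rewrite subr_gt0.
exists ((delta / Q) `^ (1 - p)^-1); first by apply: powR_gt0; exact: divr_gt0.
move=> h a g h0 ca aC gG dag.
have ch : 0 < c / h by rewrite divr_gt0.
have Ch : 0 < C / h by rewrite divr_gt0.
have afin : a \is a fin_num.
  by rewrite fin_numE -ltNye -ltey (lt_le_trans _ ca) ?ltNyr// (le_lt_trans aC) ?ltry.
rewrite -(fineK afin) in ca aC dag; set A := fine a in ca aC dag.
rewrite !lee_fin in ca aC; rewrite poweR_EFin in dag.
have A0 : 0 < A by exact: lt_le_trans ca.
have Ap : A `^ p <= (C `^ p + c `^ p) * h `^ (- p).
  have powRdiv (b : R) : 0 < b -> (b / h) `^ p = b `^ p * h `^ (- p).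
    move=> b0; rewrite powRM ?(ltW b0) ?invr_ge0 ?(ltW h0)//.
    by rewrite -(powR_inv1 (ltW h0)) -powRrM mulN1r.
  have [p0|p0] := leP 0 p.
    apply: (@le_trans _ _ ((C / h) `^ p)).
      by apply: ge0_ler_powR => //; rewrite nnegrE ltW.
    by rewrite powRdiv// ler_wpM2r ?powR_ge0// lerDl powR_ge0.
  apply: (@le_trans _ _ ((c / h) `^ p)).
    rewrite -[p]opprK !(powRN _ (- p)) lef_pV2 ?posrE ?powR_gt0//.
    by apply: ge0_ler_powR => //; rewrite ?nnegrE ?oppr_ge0 ltW.
  by rewrite powRdiv// ler_wpM2r ?powR_ge0// lerDr powR_ge0.
have dQ : delta <= Q * h `^ (1 - p).
  rewrite -lee_fin; apply: le_trans dag _.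
  apply: (@le_trans _ _ ((A `^ p)%:E * (G * h)%:E)%E).
    by apply: lee_wpmul2l => //; rewrite lee_fin powR_ge0.
  rewrite -EFinM lee_fin powRD; last by rewrite gt_eqF// implybT.
  rewrite powRr1 ?(ltW h0)//.
  have -> : Q * (h * h `^ (- p)) = (C `^ p + c `^ p) * h `^ (- p) * (G * h).
    by rewrite /Q; ring.
  by rewrite ler_wpM2r// mulr_ge0// ltW.
rewrite leNgt; apply/negP => hlt.
have : h `^ (1 - p) < delta / Q.
  have -> : delta / Q = ((delta / Q) `^ (1 - p)^-1) `^ (1 - p).
    by rewrite -powRrM mulVf ?gt_eqF// powRr1// divr_ge0 ?ltW.
  by apply: gt0_ltr_powR => //; rewrite nnegrE ?powR_ge0 ?ltW.
by rewrite ltr_pdivlMr// mulrC ltNge dQ.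
Qed.

End power_bound.

Section main.
Variables (R : realType) (d : nat).
Local Notation V := 'rV[R]_d.
Implicit Types (Om : set V) (u : V -> R).

Lemma gradient_sup_norm_le Om u (c : R) : 0 <= c ->
  (forall x, Om x -> enorm (gradient u x) <= c) ->
  (gradient_sup_norm Om u <= c%:E)%E.
Proof.
(* The norm is an essential supremum, or 0 by convention when the whole space is null. The pointwise
   bound allows an empty exceptional set. *)
move=> c0 uc; rewrite /gradient_sup_norm unlock /Lnorm; case: ifP => _; last first.
  by rewrite lee_fin.
apply: ereal_inf_lbound => /=; exists set0; split; first exact: measurable0.
  exact: lebesgue_outer0.
apply: subsetCl; rewrite setC0 => x _ /=.
rewrite patchE; case: ifPn => [/set_mem Ox|_]; last by rewrite abse0 lee_fin.
by rewrite /= lee_fin ger0_norm ?enorm_ge0// uc.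
Qed.

Lemma unit_domain_estimates : (1 < d)%N ->
  exists (c C G rho : R), [/\ 0 < c, 0 < C, 0 < G, 0 < rho &
    forall Om u, convex_domain Om -> volume Om = 1%E -> torsion_function Om u ->
    exists (h : R) (q : V), [/\ 0 < h, cube q (rho * h) `<=` Om,
      ((c / h)%:E <= surface_area Om)%E, (surface_area Om <= (C / h)%:E)%E &
      (gradient_sup_norm Om u <= (G * h)%:E)%E]].
Proof.
move=> d1; have d0 : (0 < d)%N by exact: ltnW.
have d0' : 0 < d%:R :> R by rewrite ltr0n.
have [C1 C10 ub] := @surface_area_le R d d1.
have [c1 c10 lb] := @surface_area_ge R d d1.
pose rho : R := (4 * d%:R ^+ 2)^-1.
have rho0 : 0 < rho by rewrite invr_gt0 mulr_gt0// exprn_gt0.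
exists (2 * c1 / 5), (C1 / rho), (d%:R ^+ 2), rho; split => //.
- by rewrite divr_gt0// mulr_gt0.
- by rewrite divr_gt0.
- by rewrite exprn_gt0.
move=> Om u [oOm [p0 Op0] /convex_setP cOm] vOm tu.
have {}vOm : lebesgue_outer Om = 1%E by exact: vOm.
have [r r0 rOm] := open_cube oOm Op0.
(* This bound depends on [Om]; only its finiteness counts, for the supremum in [convex_slab] and for
   compactness. *)
pose D := 4 * r / r ^+ d.
have OmD x : Om x -> `|x - p0| <= D.
  by apply: (convex_diameter cOm r0 rOm); rewrite vOm.
have OmB x : Om x -> `|x| <= D + `|p0|.
  move=> /OmD xD; rewrite -[x](subrK p0).
  by apply: le_trans (ler_normD _ _) _; rewrite lerD2r.
have [w [q [w0 wOm qOm]]] := convex_slab d0 cOm oOm Op0 OmD.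
have W0 := enorm_gt0 w0; set W := enorm w in W0 qOm.
pose h := 2 / W; have h0 : 0 < h by rewrite divr_gt0.
have hE : (2 * d%:R ^+ 2 * W)^-1 = rho * h.
  by rewrite /rho /h; field; rewrite !gt_eqF.
rewrite hE in qOm.
have rh0 : 0 < rho * h by rewrite mulr_gt0.
exists h, q; split => //.
(* Translation by [v] changes [dot w] by 5, more than the total width 4 of the slab, so that it
   leaves [Om]; its length is [5 / W], that is [5 h / 2]. *)
- pose v := (5 / W ^+ 2) *: w.
  have wv : dot w v = 5.
    by rewrite dotZr -sqr_enorm -/W divfK// gt_eqF// exprn_gt0.
  have ev : enorm v = 5 / W.
    rewrite enormE dotZl dotZr -sqr_enorm -/W.
    have -> : 5 / W ^+ 2 * (5 / W ^+ 2 * W ^+ 2) = (5 / W) ^+ 2.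
      by field; rewrite gt_eqF.
    by rewrite sqrtr_sqr ger0_norm// divr_ge0// ltW.
  have v0 : 0 < `|v|.
    rewrite normr_gt0; apply/negP => /eqP v0.
    have := wv; rewrite v0 -(scale0r 0) dotZr mul0r => /eqP.
    by rewrite eq_sym pnatr_eq0.
  apply: le_trans (lb Om v vOm v0 _); last first.
    move=> x Ox; apply: ray_boundary => // Oxv.
    have := wOm _ Ox; have := wOm _ Oxv.
    have -> : x + 1 *: v - p0 = (x - p0) + v by rewrite scale1r addrAC.
    rewrite dotDr wv !ler_norml; lra.
  rewrite lee_fin.
  have -> : 2 * c1 / 5 / h = c1 / (5 / W) by rewrite /h; field; rewrite gt_eqF.
  rewrite ler_pM2l// lef_pV2 ?posrE ?divr_gt0//.
  by rewrite -ev norm_le_enorm.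
- have := ub Om q (rho * h) cOm oOm vOm rh0 qOm.
  have -> // : C1 / rho / h = C1 / (rho * h) by field; rewrite !gt_eqF.
- apply: gradient_sup_norm_le; first by rewrite mulr_ge0 ?exprn_ge0// ltW.
  apply: (torsion_gradient d0 oOm tu OmB cOm r0 rOm h0).
  move=> x cx; apply: le_trans (torsion_slab d0 oOm tu OmB w0 wOm cx) _.
  rewrite -/W le_eqVlt; apply/orP; left; apply/eqP.
  by rewrite /h; field; rewrite gt_eqF.
Qed.

Lemma translateE (v : V) Om x : translate v Om x <-> Om (x - v).
Proof.
split => [[y Oy <-]|Ox]; first by rewrite addrC addKr.
by exists (x - v) => //; rewrite addrC subrK.
Qed.

End main.

Unset Implicit Arguments.
Set Strict Implicit.
Set Printing Implicit Defensive.

Theorem corollary1p5 (R : realType) (d : nat) (hd : (2 <= d)%N)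
  (alpha : R) (halpha : alpha < d%:R)
  (Omega : nat -> set 'rV[R]_d) (u : nat -> 'rV[R]_d -> R)
  (hOmega : forall k, convex_domain (Omega k))
  (hvol : forall k, volume (Omega k) = 1%E)
  (hu : forall k, torsion_function (Omega k) (u k))
  (hliminf : (0 < limn_einf (fun k =>
     surface_area (Omega k) `^ ((alpha - 1) / (d%:R - 1)) *
     gradient_sup_norm (Omega k) (u k)))%E) :
  (exists (M : R) (v : nat -> 'rV[R]_d), forall k l,
     (hausdorff_dist (translate (v k) (Omega k)) (translate (v l) (Omega l))
      <= M%:E)%E) /\
  (exists (v : nat -> 'rV[R]_d) (phi : nat -> nat) (L : set 'rV[R]_d),
     [/\ forall i j, (i < j)%N -> (phi i < phi j)%N,
         convex_domain L &
         (fun k => hausdorff_dist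
           (translate (v (phi k)) (Omega (phi k))) L) @ \oo --> 0%E]).
Proof.
have d1 : 1 < d%:R :> R by rewrite ltr1n.
have p1 : (alpha - 1) / (d%:R - 1) < 1 by rewrite ltr_pdivrMr; lra.
have [c [C [G [rho [c0 C0 G0 rho0 est]]]]] := @unit_domain_estimates R d hd.
have [delta [K [delta0 Kdelta]]] := limn_einf_gt0 hliminf.
have [h0 h00 hP] := product_lower_bound p1 c0 C0 G0 delta0.
pose r := rho * h0; have r0 : 0 < r by rewrite mulr_gt0.
pose D := 4 * r / r ^+ d.
have cvxO k : convex (Omega k) by have [_ _ /convex_setP] := hOmega k.
have openO k : open (Omega k) by have [] := hOmega k.
have volO k : (lebesgue_outer (Omega k) <= 1)%E by rewrite -(hvol k).
(* A centre and a radius for each domain. The lower limit controls only the indices from [K] on,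
   which get the common radius [D]; each earlier domain has its own. *)
have [q qP] : {q : nat -> 'rV[R]_d * R & forall k, [/\ Omega k (q k).1,
    forall x, Omega k x -> `|x - (q k).1| <= (q k).2 &
    (K <= k)%N -> cube (q k).1 r `<=` Omega k /\ (q k).2 = D]}.
  apply: (@choice _ _ (fun k (q : 'rV[R]_d * R) => [/\ Omega k q.1,
    forall x, Omega k x -> `|x - q.1| <= q.2 &
    (K <= k)%N -> cube q.1 r `<=` Omega k /\ q.2 = D])) => k.
  have [Kk|kK] := leqP K k.
    have [h [q [h0' qO cA AC gG]]] := est _ _ (hOmega k) (hvol k) (hu k).
    have hh0 : h0 <= h by exact: hP h0' cA AC gG (Kdelta k Kk).
    have rO : cube q r `<=` Omega k.
      move=> x qx; apply: qO; rewrite /cube /= in qx *; apply: le_trans qx _.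
      by rewrite ler_pM2l.
    exists (q, D); split => //=; first exact: cube_center (ltW r0) rO.
    by move=> x Ox; exact: (convex_diameter (cvxO k) r0 rO (volO k)).
  have [_ [p Op] _] := hOmega k.
  have [s s0 sO] := open_cube (openO k) Op.
  exists (p, 4 * s / s ^+ d); split => //= x Ox.
  exact: (convex_diameter (cvxO k) s0 sO (volO k)).
pose v k := - (q k).1.
pose A k := translate (v k) (Omega k).
have AE k x : A k x <-> Omega k (x + (q k).1) by rewrite /A translateE opprK.
have A0 k : A k 0 by apply/AE; rewrite add0r; have [] := qP k.
have AM k x : A k x -> `|x| <= (q k).2.
  by move=> /AE; have [_ qD _] := qP k; move=> /qD; rewrite addrK.
have D0 k : 0 <= (q k).2 by have := AM k 0 (A0 k); rewrite normr0.
split.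
  pose M := \sum_(k < K) (q k).2 + D.
  have qM k : (q k).2 <= M.
    have [Kk|kK] := leqP K k.
      have [_ _ /(_ Kk)[_ ->]] := qP k.
      by rewrite /M lerDr; apply: sumr_ge0 => i _.
    have DD : 0 <= D by have [_ _ /(_ (leqnn K))[_ <-]] := qP K.
    rewrite /M (bigD1 (Ordinal kK))//= -addrA lerDl addr_ge0//.
    by apply: sumr_ge0 => i _.
  (* Every translate contains 0, so 0 is a point of the other set within [M] of any point of the
     first. *)
  exists (d%:R * M), v => k l; apply: hausdorff_dist_le => x Ax; exists 0; try exact: A0.
    by rewrite subr0 (le_trans (AM _ _ Ax)).
  by rewrite subr0 (le_trans (AM _ _ Ax)).
(* The first [K] domains are dropped, since the cube of radius [r] is guaranteed only for the later
   ones. *)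
have [|||| phi [L [phi_lt oL L0 cL AL]]] := @blaschke_selection R d (fun k => A (K + k)%N) D r.
- move=> k x y t /AE Ax /AE Ay t01; apply/AE.
  have -> : t *: x + (1 - t) *: y + (q (K + k)%N).1 =
     t *: (x + (q (K + k)%N).1) + (1 - t) *: (y + (q (K + k)%N).1).
    by apply/rowP => i; rewrite !mxE; ring.
  exact: cvxO.
- exact: r0.
- move=> k x xr; apply/AE; have [_ _ /(_ (leq_addr _ _))[qO _]] := qP (K + k)%N.
  by apply: qO; rewrite /cube /= in xr *; rewrite addrK; rewrite subr0 in xr.
- move=> k x /AM; have [_ _ /(_ (leq_addr _ _))[_ ->]] := qP (K + k)%N.
  by [].
exists v, (fun k => (K + phi k)%N), L; split.
- by move=> i j ij; rewrite ltn_add2l phi_lt.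
- by split => //; apply/convex_setP.
- apply: hausdorff_dist_cvg0 => k; last exact: AL.
  by exists 0; exact: A0.
Qed.
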